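(* In the category $\mathrm{Fun}$ of functors from finitely generated free abelian groups to abelian groups, $$\operatorname{Ext}^1_{\mathrm{Fun}}(\Gamma^3,S^3)\cong\mathbb{Z}/2 .$$
   Context: $\mathrm{Fun}$ is the abelian category of all functors from finitely generated free $\mathbb{Z}$-modules to $\mathbb{Z}$-modules. $S^3$ and $\Gamma^3$ denote the third symmetric power and third divided power functors over $\mathbb{Z}$. *)

(* Defs.v *)
From HB Require Import structures.
From mathcomp Require Import all_boot fingroup perm all_algebra generic_quotient.
From mathcomp Require Import boolp.
From mathcomp Require Import freeg.

Set Implicit Arguments.
Unset Strict Implicit.
Unset Printing Implicit Defensive.

Import GRing.Theory.
Local Open Scope ring_scope.
Local Open Scope quotient_scope.

(* -------------------------------------------------------------------- *)
(* Abelian groups are [zmodType]s, a subgroup of G is a [zmodClosed G],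
   and the quotient of G by H is the library's [Quotient.quot H].         *)

Section Subgroup.
Variables (G : zmodType) (H : zmodClosed G).

Record subgp := Subgp { subgp_val : G; _ : subgp_val \in H }.

HB.instance Definition _ := [isSub for subgp_val].
HB.instance Definition _ := [Choice of subgp by <:].
HB.instance Definition _ := [SubChoice_isSubZmodule of subgp by <:].

Lemma subgp_valP (x : subgp) : subgp_val x \in H.
Proof. exact: valP. Qed.

End Subgroup.

Section GeneratedSubgroup.
Variables (G : zmodType) (A : G -> Prop).

Definition gen_sub : {pred G} :=
  fun x => `[< forall H : zmodClosed G, (forall a, A a -> a \in H) -> x \in H >].

Lemma gen_sub_zmod_closed : zmod_closed gen_sub.
Proof.
split=> [|x y /asboolP Hx /asboolP Hy]; apply/asboolP => H AH.
  exact: rpred0.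
by rewrite rpredB ?Hx ?Hy.
Qed.

HB.instance Definition _ := GRing.isZmodClosed.Build G gen_sub gen_sub_zmod_closed.

Lemma mem_gen_sub a : A a -> a \in gen_sub.
Proof. by move=> Aa; apply/asboolP => H; apply. Qed.

Lemma gen_sub_min (H : zmodClosed G) :
  (forall a, A a -> a \in H) -> {subset gen_sub <= H}.
Proof. by move=> AH x /asboolP; apply. Qed.

End GeneratedSubgroup.

Section Preimage.
Variables (G G' : zmodType) (f : {additive G -> G'}) (H : zmodClosed G').

Definition preim_sub : {pred G} := fun x => f x \in H.

Lemma preim_sub_zmod_closed : zmod_closed preim_sub.
Proof.
split=> [|x y Hx Hy]; rewrite unfold_in /preim_sub ?raddf0 ?rpred0 //.
by rewrite raddfB rpredB.
Qed.

HB.instance Definition _ :=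
  GRing.isZmodClosed.Build G preim_sub preim_sub_zmod_closed.

End Preimage.

Lemma gen_sub_map (G G' : zmodType) (f : {additive G -> G'})
    (A : G -> Prop) (H : zmodClosed G') :
  (forall a, A a -> f a \in H) -> forall x, x \in gen_sub A -> f x \in H.
Proof. by move=> AH; apply: (gen_sub_min (H := preim_sub f H)). Qed.

Lemma quot_eqP (G : zmodType) (H : zmodClosed G) (x y : G) :
  reflect (x = y %[mod Quotient.quot H]) (x - y \in H).
Proof. by rewrite Quotient.idealrBE; apply: eqP. Qed.

Section QuotMap.
Variables (G G' : zmodType) (H : zmodClosed G) (H' : zmodClosed G').
Variables (f : {additive G -> G'}) (fH : forall x, x \in H -> f x \in H').

Definition quot_fun (x : Quotient.quot H) : Quotient.quot H' :=
  \pi_(Quotient.quot H') (f (repr x)).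

Lemma quot_funE x :
  quot_fun (\pi_(Quotient.quot H) x) = \pi_(Quotient.quot H') (f x).
Proof.
apply/eqP; rewrite -Quotient.idealrBE -raddfB; apply: fH.
by rewrite Quotient.idealrBE reprK.
Qed.

Lemma quot_fun_is_zmod_morphism : zmod_morphism quot_fun.
Proof.
move=> x y; rewrite -[x]reprK -[y]reprK -(raddfB (\pi_(Quotient.quot H))).
by rewrite !quot_funE !raddfB.
Qed.

Definition quot_map : {additive Quotient.quot H -> Quotient.quot H'} :=
  HB.pack quot_fun (GRing.isZmodMorphism.Build (Quotient.quot H) (Quotient.quot H')
                      quot_fun quot_fun_is_zmod_morphism).

Lemma quot_mapE x :
  quot_map (\pi_(Quotient.quot H) x) = \pi_(Quotient.quot H') (f x).
Proof. exact: quot_funE. Qed.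

End QuotMap.
Arguments quot_fun : simpl never.
Arguments quot_map {G G'} H H' f fH : simpl never.

Section SubMap.
Variables (G G' : zmodType) (H : zmodClosed G) (H' : zmodClosed G').
Variables (f : {additive G -> G'}) (fH : forall x, x \in H -> f x \in H').

Definition sub_map (x : subgp H) : subgp H' := Subgp (fH (subgp_valP x)).

Lemma sub_map_is_zmod_morphism : zmod_morphism sub_map.
Proof. by move=> x y; apply: val_inj; rewrite /= raddfB. Qed.

HB.instance Definition _ :=
  GRing.isZmodMorphism.Build (subgp H) (subgp H') sub_map sub_map_is_zmod_morphism.

End SubMap.
Arguments sub_map {G G'} H H' f fH x.

Section PairMap.
Variables (G1 G2 G1' G2' : zmodType).
Variables (f1 : {additive G1 -> G1'}) (f2 : {additive G2 -> G2'}).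

Definition pair_map (x : (G1 * G2)%type) : (G1' * G2')%type := (f1 x.1, f2 x.2).

Lemma pair_map_is_zmod_morphism : zmod_morphism pair_map.
Proof. by move=> x y; rewrite /pair_map /= !raddfB. Qed.

HB.instance Definition _ :=
  GRing.isZmodMorphism.Build (G1 * G2)%type (G1' * G2')%type pair_map
    pair_map_is_zmod_morphism.

End PairMap.

(* -------------------------------------------------------------------- *)
(* The free abelian group on a set. *)

Definition freeab (K : choiceType) : zmodType := {freeg K / int}.

Definition fgen (K : choiceType) (k : K) : freeab K := << k >>.

Section FreeLift.
Variables (K : choiceType) (M : zmodType) (h : K -> M).

Definition free_lift : freeab K -> M := fglift (M := zmodule M) h.

Lemma free_lift_is_zmod_morphism : zmod_morphism free_lift.
Proof. by move=> x y; exact: (@lift_is_additive int K (zmodule M)). Qed.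

HB.instance Definition _ :=
  GRing.isZmodMorphism.Build (freeab K) M free_lift free_lift_is_zmod_morphism.

Lemma free_liftE k : free_lift (fgen k) = h k.
Proof. by rewrite /free_lift /fgen liftU scale1r. Qed.

End FreeLift.

Lemma free_ext (K : choiceType) (M : zmodType) (f g : {additive freeab K -> M}) :
  (forall k, f (fgen k) = g (fgen k)) -> f =1 g.
Proof.
move=> fg; elim/freeg_ind_dom0 => [|c k x _ _ IH].
  exact: etrans (raddf0 f) (esym (raddf0 g)).
apply: (etrans (raddfD f _ _)); apply/esym; apply: (etrans (raddfD g _ _)).
rewrite IH; congr (_ + _).
suff -> : << c *g k >> = fgen k *~ c by rewrite !raddfMz fg.
apply/eqP/freeg_eqP => k'; rewrite (raddfMz (coeff k')) /fgen /= !coeffU.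
by rewrite mul1r -mulrzl intz.
Qed.

(* -------------------------------------------------------------------- *)
(* The d-fold tensor power over Z of an abelian group V: the free abelian group
   on V^d modulo additivity in each argument.  The symmetric group 'S_d permutes
   the factors; invariants and coinvariants do not depend on whether this is
   read as a left or a right action.                                        *)

Definition subst_arg (V : Type) (d : nat) (v : {ffun 'I_d -> V}) (i : 'I_d) (x : V) :
  {ffun 'I_d -> V} := [ffun j => if j == i then x else v j].

Inductive multilinear_relator (V : zmodType) (d : nat) :
    freeab {ffun 'I_d -> V} -> Prop :=
  MultilinearRelator v i x y : multilinear_relator
    (fgen (subst_arg v i (x + y)) - fgen (subst_arg v i x) - fgen (subst_arg v i y)).

Definition tpow (d : nat) (V : zmodType) : zmodType :=
  Quotient.quot (gen_sub (@multilinear_relator V d)).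

Definition pure_tensor (d : nat) (V : zmodType) (v : {ffun 'I_d -> V}) : tpow d V :=
  \pi_(tpow d V) (fgen v).

Lemma tpow_ext (d : nat) (V M : zmodType) (f g : {additive tpow d V -> M}) :
  (forall v, f (pure_tensor v) = g (pure_tensor v)) -> f =1 g.
Proof.
move=> fg t; rewrite -[t]reprK.
set p : {additive _ -> tpow d V} := \pi_(Quotient.quot _).
exact: (free_ext (f := f \o p) (g := g \o p)).
Qed.

Section TensorMap.
Variables (d : nat) (V W : zmodType) (g : {additive V -> W}).

Lemma tpow_map_subproof (x : freeab {ffun 'I_d -> V}) :
  x \in gen_sub (@multilinear_relator V d) ->
  free_lift (fun v : {ffun 'I_d -> V} => fgen [ffun i => g (v i)]) x
    \in gen_sub (@multilinear_relator W d).
Proof.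
apply: gen_sub_map => _ [v i x1 x2]; rewrite !raddfB /= !free_liftE.
have E y : [ffun j => g (subst_arg v i y j)] =
           subst_arg [ffun j => g (v j)] i (g y).
  by apply/ffunP => j; rewrite !ffunE; case: eqP.
by rewrite !E raddfD; apply: mem_gen_sub.
Qed.

Definition tpow_map : tpow d V -> tpow d W := quot_map _ _ _ tpow_map_subproof.

HB.instance Definition _ := GRing.isZmodMorphism.Build (tpow d V) (tpow d W) tpow_map
  (raddfB (quot_map _ _ _ tpow_map_subproof)).

Lemma tpow_mapE v : tpow_map (pure_tensor v) = pure_tensor [ffun i => g (v i)].
Proof. by rewrite /tpow_map /pure_tensor quot_mapE /= free_liftE. Qed.

End TensorMap.
Arguments tpow_map d {V W} g : simpl never.

Section TensorPerm.
Variables (d : nat) (V : zmodType) (s : 'S_d).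

Lemma tpow_perm_subproof (x : freeab {ffun 'I_d -> V}) :
  x \in gen_sub (@multilinear_relator V d) ->
  free_lift (fun v : {ffun 'I_d -> V} => fgen [ffun i => v (s i)]) x
    \in gen_sub (@multilinear_relator V d).
Proof.
apply: gen_sub_map => _ [v i x1 x2]; rewrite !raddfB /= !free_liftE.
have E y : [ffun j => subst_arg v i y (s j)] =
           subst_arg [ffun j => v (s j)] (s^-1 i)%g y.
  by apply/ffunP => j; rewrite !ffunE (can2_eq (permK s) (permKV s)).
by rewrite !E; apply: mem_gen_sub.
Qed.

Definition tpow_perm : tpow d V -> tpow d V := quot_map _ _ _ tpow_perm_subproof.

HB.instance Definition _ := GRing.isZmodMorphism.Build (tpow d V) (tpow d V) tpow_perm
  (raddfB (quot_map _ _ _ tpow_perm_subproof)).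

Lemma tpow_permE v : tpow_perm (pure_tensor v) = pure_tensor [ffun i => v (s i)].
Proof. by rewrite /tpow_perm /pure_tensor quot_mapE /= free_liftE. Qed.

End TensorPerm.
Arguments tpow_perm {d V} s : simpl never.

Lemma tpow_map_perm (d : nat) (V W : zmodType) (g : {additive V -> W}) (s : 'S_d) t :
  tpow_map d g (tpow_perm s t) = tpow_perm s (tpow_map d g t).
Proof.
apply: (tpow_ext (f := tpow_map d g \o tpow_perm s)
                 (g := tpow_perm s \o tpow_map d g)) => v /=.
rewrite tpow_permE !tpow_mapE tpow_permE; congr pure_tensor.
by apply/ffunP => i; rewrite !ffunE.
Qed.

Lemma tpow_map_id (d : nat) (V : zmodType) (t : tpow d V) :
  tpow_map d (idfun : {additive V -> V}) t = t.
Proof.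
apply: (tpow_ext (f := tpow_map d _) (g := idfun)) => v /=.
rewrite tpow_mapE; congr pure_tensor; by apply/ffunP => i; rewrite !ffunE.
Qed.

Lemma tpow_map_comp (d : nat) (U V W : zmodType)
    (g : {additive V -> W}) (f : {additive U -> V}) t :
  tpow_map d (g \o f : {additive U -> W}) t = tpow_map d g (tpow_map d f t).
Proof.
apply: (tpow_ext (f := tpow_map d _) (g := tpow_map d g \o tpow_map d f)) => v /=.
rewrite !tpow_mapE; congr pure_tensor; by apply/ffunP => i; rewrite !ffunE.
Qed.

(* -------------------------------------------------------------------- *)
(* S^d(V) is the group of coinvariants, and Gamma^d(V) the group of invariants,
   of the action of 'S_d on the d-th tensor power.  For V free, Gamma^d(V) is
   the degree d part of the divided power algebra, the d-th divided power of v
   being the tensor v (x) ... (x) v.                                        *)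

Inductive sym_relator (d : nat) (V : zmodType) : tpow d V -> Prop :=
  SymRelator s t : sym_relator (tpow_perm s t - t).

Definition spow (d : nat) (V : zmodType) : zmodType :=
  Quotient.quot (gen_sub (@sym_relator d V)).

Section SymMap.
Variables (d : nat) (V W : zmodType) (g : {additive V -> W}).

Lemma spow_map_subproof t :
  t \in gen_sub (@sym_relator d V) -> tpow_map d g t \in gen_sub (@sym_relator d W).
Proof.
apply: gen_sub_map => _ [s t']; rewrite raddfB /= tpow_map_perm.
exact: mem_gen_sub.
Qed.

Definition spow_map : spow d V -> spow d W := quot_map _ _ _ spow_map_subproof.

HB.instance Definition _ := GRing.isZmodMorphism.Build (spow d V) (spow d W) spow_map
  (raddfB (quot_map _ _ _ spow_map_subproof)).

Lemma spow_mapE t : spow_map (\pi_(spow d V) t) = \pi_(spow d W) (tpow_map d g t).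
Proof. by rewrite /spow_map quot_mapE. Qed.

End SymMap.
Arguments spow_map d {V W} g : simpl never.

Section Gamma.
Variables (d : nat) (V : zmodType).

Definition sym_tensor : {pred tpow d V} := fun t => [forall s : 'S_d, tpow_perm s t == t].

Lemma sym_tensor_zmod_closed : zmod_closed sym_tensor.
Proof.
split=> [|x y /forallP Hx /forallP Hy]; apply/forallP => s; first by rewrite raddf0.
by rewrite raddfB /= (eqP (Hx s)) (eqP (Hy s)).
Qed.

HB.instance Definition _ :=
  GRing.isZmodClosed.Build (tpow d V) sym_tensor sym_tensor_zmod_closed.

Definition gpow : zmodType := subgp sym_tensor.

End Gamma.

Section GammaMap.
Variables (d : nat) (V W : zmodType) (g : {additive V -> W}).

Lemma gpow_map_subproof t :
  t \in @sym_tensor d V -> tpow_map d g t \in @sym_tensor d W.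
Proof.
by move/forallP=> Ht; apply/forallP => s; rewrite -tpow_map_perm (eqP (Ht s)).
Qed.

Definition gpow_map : gpow d V -> gpow d W := sub_map _ _ _ gpow_map_subproof.

HB.instance Definition _ := GRing.isZmodMorphism.Build (gpow d V) (gpow d W) gpow_map
  (raddfB (sub_map _ _ _ gpow_map_subproof)).

End GammaMap.
Arguments gpow_map d {V W} g : simpl never.

(* -------------------------------------------------------------------- *)
(* The category Fun: functors from f.g. free Z-modules to Z-modules.      *)

Record fgfree := FgFree {
  fgfree_mod :> zmodType;
  fgfree_basis : exists (n : nat) (e : {additive 'rV[int]_n -> fgfree_mod}), bijective e
}.

Record functor := Functor {
  fobj :> fgfree -> zmodType;
  fmap : forall V W : fgfree, {additive V -> W} -> {additive fobj V -> fobj W};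
  fmap_id : forall V : fgfree, fmap (idfun : {additive V -> V}) =1 idfun;
  fmap_comp : forall (U V W : fgfree) (g : {additive V -> W}) (f : {additive U -> V}),
    fmap (g \o f : {additive U -> W}) =1 fmap g \o fmap f
}.

Record nattrans (A B : functor) := NatTrans {
  nt :> forall V : fgfree, {additive A V -> B V};
  nt_natural : forall (V W : fgfree) (f : {additive V -> W}) (x : A V),
    nt W (fmap A f x) = fmap B f (nt V x)
}.

Section SymGamma.
Variable d : nat.

Lemma spow_map_id (V : fgfree) : spow_map d (idfun : {additive V -> V}) =1 idfun.
Proof.
by move=> x; rewrite -[x]reprK spow_mapE tpow_map_id.
Qed.

Lemma spow_map_comp (U V W : fgfree) (g : {additive V -> W}) (f : {additive U -> V}) :
  spow_map d (g \o f : {additive U -> W}) =1 spow_map d g \o spow_map d f.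
Proof.
move=> x; rewrite -[x]reprK -[RHS]/(spow_map d g (spow_map d f _)).
by rewrite (spow_mapE f) !spow_mapE tpow_map_comp.
Qed.

Definition Sym : functor :=
  @Functor (spow d) (fun V W g => spow_map d g) spow_map_id spow_map_comp.

Lemma gpow_map_id (V : fgfree) : gpow_map d (idfun : {additive V -> V}) =1 idfun.
Proof. by move=> x; apply: val_inj; rewrite /= tpow_map_id. Qed.

Lemma gpow_map_comp (U V W : fgfree) (g : {additive V -> W}) (f : {additive U -> V}) :
  gpow_map d (g \o f : {additive U -> W}) =1 gpow_map d g \o gpow_map d f.
Proof. by move=> x; apply: val_inj; rewrite /= tpow_map_comp. Qed.

Definition Gamma : functor :=
  @Functor (gpow d) (fun V W g => gpow_map d g) gpow_map_id gpow_map_comp.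

End SymGamma.

(* -------------------------------------------------------------------- *)
(* Yoneda extensions 0 -> B -> E -> A -> 0 and the group Ext^1(A, B).     *)

Section Ext.
Variables A B : functor.

(* Kernels and cokernels in Fun, hence exactness, are computed objectwise. *)
Record extension := Extension {
  ext_mid :> functor;
  ext_in : nattrans B ext_mid;
  ext_pr : nattrans ext_mid A;
  ext_inj : forall V, injective (ext_in V);
  ext_exact : forall V x, ext_pr V x = 0 <-> exists b, ext_in V b = x;
  ext_surj : forall V y, exists x, ext_pr V x = y
}.

Definition ext_equiv (E E' : extension) : Prop :=
  exists phi : nattrans E E',
    (forall V b, phi V (ext_in E V b) = ext_in E' V b) /\
    (forall V x, ext_pr E' V (phi V x) = ext_pr E V x).

Lemma ext_equiv_refl E : ext_equiv E E.
Proof.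
by exists (@NatTrans E E (fun V => idfun) (fun V W f x => erefl)).
Qed.

Lemma ext_equiv_trans E1 E2 E3 :
  ext_equiv E1 E2 -> ext_equiv E2 E3 -> ext_equiv E1 E3.
Proof.
move=> [phi [phii phip]] [psi [psii psip]].
have nat (V W : fgfree) (f : {additive V -> W}) x :
    (psi W \o phi W) (fmap E1 f x) = fmap E3 f ((psi V \o phi V) x).
  by rewrite /= !nt_natural.
exists (NatTrans nat); split=> V x /=; first by rewrite phii psii.
by rewrite psip phip.
Qed.

Lemma ext_equiv_bij (E E' : extension) (phi : nattrans E E') :
  (forall V b, phi V (ext_in E V b) = ext_in E' V b) ->
  (forall V x, ext_pr E' V (phi V x) = ext_pr E V x) ->
  forall V, injective (phi V) /\ forall y, exists x, phi V x = y.
Proof.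
move=> phii phip V; split.
  apply: raddf_inj => x phix.
  have /ext_exact[b xE] : ext_pr E V x = 0 by rewrite -phip phix raddf0.
  have : ext_in E' V b = 0 by rewrite -phii xE.
  by rewrite -xE -(raddf0 (ext_in E' V)) => /ext_inj ->; rewrite raddf0.
move=> y; have [x xE] := ext_surj E (ext_pr E' V y).
have /ext_exact[b bE] : ext_pr E' V (y - phi V x) = 0.
  by rewrite raddfB phip xE subrr.
by exists (x + ext_in E V b); rewrite raddfD phii bE addrC subrK.
Qed.

Lemma ext_equiv_sym E E' : ext_equiv E E' -> ext_equiv E' E.
Proof.
move=> [phi [phii phip]]; have bij := ext_equiv_bij phii phip.
pose psi V y := sval (cid ((bij V).2 y)).
have phiK V y : phi V (psi V y) = y by rewrite /psi; case: cid.
have psiK V x : psi V (phi V x) = x by apply: (bij V).1; rewrite phiK.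
have psi_add V : zmod_morphism (psi V).
  by move=> x y; apply: (bij V).1; rewrite raddfB !phiK.
pose psiA V : {additive E' V -> E V} :=
  HB.pack (psi V) (GRing.isZmodMorphism.Build _ _ _ (psi_add V)).
have nat (V W : fgfree) (f : {additive V -> W}) x : psiA W (fmap E' f x) = fmap E f (psiA V x).
  by apply: (bij W).1; rewrite nt_natural !phiK.
exists (NatTrans nat); split=> V x /=; first by rewrite -phii psiK.
by rewrite -phip phiK.
Qed.

(* Baer sum: the fibre product of E1 and E2 over A, modulo the antidiagonal
   copy of B.                                                              *)
Section Baer.
Variables E1 E2 : extension.

Section Obj.
Variable V : fgfree.

Definition fib_pred : {pred (E1 V * E2 V)%type} :=
  fun x => ext_pr E1 V x.1 == ext_pr E2 V x.2.

Lemma fib_zmod_closed : zmod_closed fib_pred.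
Proof.
split=> [|x y /eqP Hx /eqP Hy]; apply/eqP; first by rewrite !raddf0.
by rewrite !raddfB Hx Hy.
Qed.

HB.instance Definition _ :=
  GRing.isZmodClosed.Build (E1 V * E2 V)%type fib_pred fib_zmod_closed.

Definition fib : zmodType := subgp fib_pred.

Definition antidiag_pred : {pred fib} := fun x =>
  `[< exists b : B V, subgp_val x = (ext_in E1 V b, - ext_in E2 V b) >].

Lemma antidiag_zmod_closed : zmod_closed antidiag_pred.
Proof.
split=> [|x y /asboolP[b xE] /asboolP[c yE]]; apply/asboolP.
  by exists 0; rewrite (raddf0 (ext_in E1 V)) (raddf0 (ext_in E2 V)) oppr0.
by exists (b - c); rewrite /= xE yE (raddfB (ext_in E1 V)) (raddfB (ext_in E2 V)) opprD.
Qed.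

HB.instance Definition _ :=
  GRing.isZmodClosed.Build fib antidiag_pred antidiag_zmod_closed.

Definition baer_obj : zmodType := Quotient.quot antidiag_pred.

End Obj.
Arguments fib_pred : clear implicits.
Arguments antidiag_pred : clear implicits.

Section Mor.
Variables (V W : fgfree) (f : {additive V -> W}).

Lemma fib_map_subproof x :
  x \in fib_pred V -> pair_map (fmap E1 f) (fmap E2 f) x \in fib_pred W.
Proof. by move/eqP=> Hx; apply/eqP; rewrite /= !nt_natural Hx. Qed.

Definition fib_map : fib V -> fib W := sub_map _ _ _ fib_map_subproof.

HB.instance Definition _ := GRing.isZmodMorphism.Build (fib V) (fib W) fib_map
  (raddfB (sub_map _ _ _ fib_map_subproof)).

Lemma baer_map_subproof x : x \in antidiag_pred V -> fib_map x \in antidiag_pred W.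
Proof.
move/asboolP=> [b xE]; apply/asboolP; exists (fmap B f b).
by rewrite /= xE /pair_map /= raddfN !nt_natural.
Qed.

Definition baer_map : {additive baer_obj V -> baer_obj W} :=
  quot_map _ _ _ baer_map_subproof.

Lemma baer_mapE x :
  baer_map (\pi_(baer_obj V) x) = \pi_(baer_obj W) (fib_map x).
Proof. by rewrite /baer_map quot_mapE. Qed.

End Mor.

Lemma baer_map_id (V : fgfree) : baer_map (idfun : {additive V -> V}) =1 idfun.
Proof.
move=> x; rewrite -[x]reprK baer_mapE; congr \pi_(baer_obj V); apply: val_inj.
by rewrite /= /pair_map !fmap_id; case: (subgp_val _).
Qed.

Lemma baer_map_comp (U V W : fgfree) (g : {additive V -> W}) (f : {additive U -> V}) :
  baer_map (g \o f : {additive U -> W}) =1 baer_map g \o baer_map f.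
Proof.
move=> x; rewrite -[x]reprK -[RHS]/(baer_map g (baer_map f _)).
rewrite (baer_mapE f) !baer_mapE; congr \pi_(baer_obj W); apply: val_inj.
by rewrite /= /pair_map !fmap_comp.
Qed.

Definition baer_mid : functor := Functor baer_map_id baer_map_comp.

Section ObjMaps.
Variable V : fgfree.

Lemma baer_in_subproof (b : B V) : (ext_in E1 V b, 0) \in fib_pred V.
Proof. by apply/eqP; rewrite /= raddf0; apply/ext_exact; exists b. Qed.

Definition baer_in_fun (b : B V) : baer_mid V :=
  \pi_(baer_obj V) (Subgp (baer_in_subproof b)).

Lemma baer_in_is_zmod_morphism : zmod_morphism baer_in_fun.
Proof.
move=> b c; rewrite /baer_in_fun -(raddfB (\pi_(baer_obj V))).
congr \pi_(baer_obj V); apply: val_inj.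
by rewrite /= (raddfB (ext_in E1 V)) -[in LHS](subr0 0).
Qed.

HB.instance Definition _ :=
  GRing.isZmodMorphism.Build (B V) (baer_mid V) baer_in_fun baer_in_is_zmod_morphism.

Definition baer_pr_fun (x : baer_mid V) : A V :=
  ext_pr E1 V (subgp_val (repr (x : baer_obj V))).1.

Lemma baer_pr_funE (x : fib V) :
  baer_pr_fun (\pi_(baer_obj V) x) = ext_pr E1 V (subgp_val x).1.
Proof.
have /quot_eqP/asboolP[b /= xE] :
  repr (\pi_(baer_obj V) x) = x %[mod baer_obj V] by rewrite reprK.
apply/eqP; rewrite -subr_eq0 -raddfB; apply/eqP/ext_exact; exists b.
by have /(congr1 fst) := xE.
Qed.

Lemma baer_pr_is_zmod_morphism : zmod_morphism baer_pr_fun.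
Proof.
move=> x y; rewrite -[x]reprK -[y]reprK -(raddfB (\pi_(baer_obj V))).
by rewrite !baer_pr_funE /= raddfB.
Qed.

HB.instance Definition _ :=
  GRing.isZmodMorphism.Build (baer_mid V) (A V) baer_pr_fun baer_pr_is_zmod_morphism.

Lemma baer_inj : injective baer_in_fun.
Proof.
apply: raddf_inj => b /=; rewrite /baer_in_fun.
rewrite -(raddf0 (\pi_(baer_obj V))) => /quot_eqP/asboolP[c /= bE].
have /(congr1 snd) /= := bE; rewrite subr0 => /esym/eqP; rewrite oppr_eq0 => /eqP.
rewrite -(raddf0 (ext_in E2 V)) => /ext_inj c0.
have /(congr1 fst) /= := bE; rewrite subr0 c0.
by move/ext_inj.
Qed.

Lemma baer_exact x : baer_pr_fun x = 0 <-> exists b, baer_in_fun b = x.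
Proof.
split=> [|[b <-]]; last first.
  by rewrite baer_pr_funE /=; apply/ext_exact; exists b.
rewrite -[x]reprK baer_pr_funE; move: (repr _) => [[x1 x2] /= x12] x10.
have /ext_exact[b1 b1E] := x10.
have /ext_exact[b2 b2E] : ext_pr E2 V x2 = 0 by rewrite -x10; apply/esym/eqP.
exists (b1 + b2); apply/quot_eqP/asboolP.
exists b2; rewrite /= raddfD b1E b2E.
by congr (_, _); rewrite ?sub0r // addrC addKr.
Qed.

Lemma baer_surj y : exists x, baer_pr_fun x = y.
Proof.
have [x1 x1E] := ext_surj E1 y; have [x2 x2E] := ext_surj E2 y.
have x12 : (x1, x2) \in fib_pred V by apply/eqP; rewrite /= x1E.
by exists (\pi_(baer_obj V) (Subgp x12)); rewrite baer_pr_funE.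
Qed.

End ObjMaps.

Lemma baer_in_natural (V W : fgfree) (f : {additive V -> W}) b :
  baer_in_fun (fmap B f b) = fmap baer_mid f (baer_in_fun b).
Proof.
rewrite /= [RHS]baer_mapE; congr \pi_(baer_obj W); apply: val_inj.
by rewrite /= /pair_map /= nt_natural raddf0.
Qed.

Lemma baer_pr_natural (V W : fgfree) (f : {additive V -> W}) x :
  baer_pr_fun (fmap baer_mid f x) = fmap A f (baer_pr_fun x).
Proof.
rewrite -[x]reprK [fmap _ _ _]baer_mapE !baer_pr_funE /=.
by rewrite nt_natural.
Qed.

Definition baer : extension :=
  @Extension baer_mid
    (@NatTrans B baer_mid (fun V => @baer_in_fun V) baer_in_natural)
    (@NatTrans baer_mid A (fun V => @baer_pr_fun V) baer_pr_natural)
    baer_inj baer_exact baer_surj.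

End Baer.
Arguments fib_pred : clear implicits.
Arguments antidiag_pred : clear implicits.

Section BaerEquiv.
Variables E1 E1' E2 E2' : extension.
Variables (phi1 : nattrans E1 E1') (phi2 : nattrans E2 E2').
Hypothesis phi1_in : forall V b, phi1 V (ext_in E1 V b) = ext_in E1' V b.
Hypothesis phi1_pr : forall V x, ext_pr E1' V (phi1 V x) = ext_pr E1 V x.
Hypothesis phi2_in : forall V b, phi2 V (ext_in E2 V b) = ext_in E2' V b.
Hypothesis phi2_pr : forall V x, ext_pr E2' V (phi2 V x) = ext_pr E2 V x.

Lemma baer_equiv_fib_subproof (V : fgfree) x :
  x \in fib_pred E1 E2 V -> pair_map (phi1 V) (phi2 V) x \in fib_pred E1' E2' V.
Proof. by move/eqP=> Hx; apply/eqP; rewrite /= phi1_pr phi2_pr. Qed.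

Definition baer_equiv_fib (V : fgfree) : {additive fib E1 E2 V -> fib E1' E2' V} :=
  HB.pack (sub_map _ _ _ (@baer_equiv_fib_subproof V))
    (GRing.isZmodMorphism.Build _ _ _ (raddfB (sub_map _ _ _ (@baer_equiv_fib_subproof V)))).

Lemma baer_equiv_subproof (V : fgfree) x :
  x \in antidiag_pred E1 E2 V -> baer_equiv_fib V x \in antidiag_pred E1' E2' V.
Proof.
move/asboolP=> [b xE]; apply/asboolP; exists b.
by rewrite /= xE /pair_map /= raddfN phi1_in phi2_in.
Qed.

Definition baer_equiv_map (V : fgfree) : {additive baer E1 E2 V -> baer E1' E2' V} :=
  quot_map _ _ _ (@baer_equiv_subproof V).

Lemma baer_equiv_mapE (V : fgfree) x :
  baer_equiv_map V (\pi_(baer_obj E1 E2 V) x) =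
    \pi_(baer_obj E1' E2' V) (baer_equiv_fib V x).
Proof. by rewrite /baer_equiv_map quot_mapE. Qed.

Lemma baer_equiv_natural (V W : fgfree) (f : {additive V -> W}) x :
  baer_equiv_map W (fmap (baer E1 E2) f x) = fmap (baer E1' E2') f (baer_equiv_map V x).
Proof.
rewrite -[x]reprK [fmap (baer E1 E2) _ _]baer_mapE !baer_equiv_mapE.
rewrite [RHS]baer_mapE; congr \pi_(baer_obj E1' E2' W); apply: val_inj.
by rewrite /= /pair_map /= !nt_natural.
Qed.

Lemma baer_equiv_maps : ext_equiv (baer E1 E2) (baer E1' E2').
Proof.
exists (NatTrans baer_equiv_natural); split=> V x /=.
  rewrite [LHS]baer_equiv_mapE; congr \pi_(baer_obj E1' E2' V); apply: val_inj.
  by rewrite /= /pair_map /= phi1_in raddf0.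
rewrite -[x]reprK [X in baer_pr_fun X]baer_equiv_mapE !baer_pr_funE.
exact: phi1_pr.
Qed.

End BaerEquiv.

Lemma baer_equiv E1 E1' E2 E2' :
  ext_equiv E1 E1' -> ext_equiv E2 E2' -> ext_equiv (baer E1 E2) (baer E1' E2').
Proof.
by move=> [phi1 [i1 p1]] [phi2 [i2 p2]]; apply: (baer_equiv_maps i1 p1 i2 p2).
Qed.

(* The set of equivalence classes.  It cannot be a [zmodType]: an extension
   quantifies over all f.g. free groups, so it lives in a larger universe. *)
Record Ext1 := MkExt1 {
  ext1_class : extension -> Prop;
  _ : exists E, ext1_class = ext_equiv E
}.

Definition ext1_of (E : extension) : Ext1 :=
  MkExt1 (ex_intro (fun E' => ext_equiv E = ext_equiv E') E erefl).

Definition ext1_repr (c : Ext1) : extension :=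
  let: MkExt1 _ cP := c in sval (cid cP).

Lemma ext1_class_inj : injective ext1_class.
Proof.
move=> [C cP] [C' cP'] /= CC'; subst C'.
by congr MkExt1; apply: Prop_irrelevance.
Qed.

Lemma ext1_reprK c : ext1_of (ext1_repr c) = c.
Proof. by apply: ext1_class_inj; case: c => C cP /=; case: cid. Qed.

Lemma ext1_of_eq E E' : ext1_of E = ext1_of E' <-> ext_equiv E E'.
Proof.
split=> [/(congr1 (fun c => ext1_class c E')) /= ->|EE'].
  exact: ext_equiv_refl.
apply: ext1_class_inj; apply: funext => F; apply: propext.
split; apply: ext_equiv_trans => //; exact: ext_equiv_sym.
Qed.

Definition ext1_add (c c' : Ext1) : Ext1 :=
  ext1_of (baer (ext1_repr c) (ext1_repr c')).

Lemma ext1_addE E E' : ext1_add (ext1_of E) (ext1_of E') = ext1_of (baer E E').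
Proof.
by apply/ext1_of_eq; apply: baer_equiv; apply/ext1_of_eq; apply: ext1_reprK.
Qed.

End Ext.

(* Main.v *)
From HB Require Import structures.
From mathcomp Require Import all_boot all_algebra.
From mathcomp Require Import fingroup perm generic_quotient boolp ring zify.
Require Import Defs.

(* Let E be an extension of Gamma^3 by S^3 and let e in E(Z) lift the divided cube
   of the generator.  The third difference T of v |-> E(v)(e) is trilinear, because
   the fourth one would be a fourth cross-effect of S^3.  It extends to a natural
   map T^3 -> E lifting the norm T^3 -> Gamma^3, and since the norm is
   multiplication by 6 on invariants, this gives a natural map r : E -> S^3 which
   is multiplication by 6 on S^3.  Hence E is recovered from the induced map
   Gamma^3 -> S^3/6.  Naturality under multiplication by 2 and 3 on Z forces r to
   vanish on the lifts E(v)(e), so this map is determined by its value at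
   gamma_2(x) y, which is 3 (2 u - T(x, x, y)) for a lift u of gamma_2(x) y; it is
   0 or 3 (x^2 y + x y^2), and the coefficient of x^2 y in 2 u - T(x, x, y) modulo
   2 is the invariant.  The nonzero value is attained by the pull-back of
   multiplication by 2 on S^3 along Gamma^3 -> Lambda^2/2 -> S^3/2, where the
   second map is x /\ y |-> x^2 y + x y^2. *)

Set Implicit Arguments.
Unset Strict Implicit.
Unset Printing Implicit Defensive.

Import GRing.Theory.
Local Open Scope ring_scope.
Local Open Scope quotient_scope.

(** * Linear identities in abelian groups, by reflection *)

Inductive zexpr := ZVar of nat | ZZero | ZAdd of zexpr & zexpr | ZOpp of zexpr | ZMuln of zexpr & nat.

Section ZEval.
Variables (M : zmodType) (env : seq M).

Fixpoint zeval e : M := match e with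
  | ZVar i => env`_i
  | ZZero => 0
  | ZAdd a b => zeval a + zeval b
  | ZOpp a => - zeval a
  | ZMuln a n => zeval a *+ n
  end.

(** The multiplicity of the i-th atom is kept as a pair (positive part, negative part) of natural
    numbers, so that [zcheck] compares integers by a computation in [nat] without subtraction. *)
Fixpoint zcoef e (i : nat) : nat * nat := match e with
  | ZVar j => (nat_of_bool (j == i), 0%N)
  | ZZero => (0%N, 0%N)
  | ZAdd a b => let p := zcoef a i in let q := zcoef b i in ((p.1 + q.1)%N, (p.2 + q.2)%N)
  | ZOpp a => let p := zcoef a i in (p.2, p.1)
  | ZMuln a n => let p := zcoef a i in ((p.1 * n)%N, (p.2 * n)%N)
  end.

Lemma zevalE e :
  zeval e = \sum_(i < size env) (env`_i *+ (zcoef e i).1 - env`_i *+ (zcoef e i).2).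
Proof.
elim: e => [j||a IHa b IHb|a IHa|a IHa n] /=; rewrite ?IHa ?IHb.
- have [lt_j|ge_j] := ltnP j (size env).
    rewrite (bigD1 (Ordinal lt_j)) //= eqxx subr0 big1 ?addr0 // => i.
    by rewrite -val_eqE eq_sym => /negbTE /= ->; rewrite subr0.
  rewrite nth_default // big1 // => i _; rewrite subr0.
  by rewrite gtn_eqF // (leq_trans (ltn_ord i)).
- by rewrite big1 // => i _; rewrite subr0.
- rewrite -big_split; apply: eq_bigr => i _ /=.
  by rewrite !mulrnDr opprD addrACA.
- by rewrite -sumrN; apply: eq_bigr => i _; rewrite opprB.
- by rewrite -sumrMnl; apply: eq_bigr => i _; rewrite !mulrnA mulrnBl.
Qed.

Definition zcheck a b :=
  all (fun i => let p := zcoef a i in let q := zcoef b i in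
                (p.1 + q.2 == q.1 + p.2)%N) (iota 0 (size env)).

Lemma zcheckP a b : zcheck a b -> zeval a = zeval b.
Proof.
move=> /allP ab; rewrite !zevalE; apply: eq_bigr => i _.
have := ab i; rewrite mem_iota /= ltn_ord => /(_ isT)/eqP abi.
apply/eqP; rewrite subr_eq addrAC -mulrnDr eq_sym subr_eq -mulrnDr.
by rewrite abi.
Qed.

End ZEval.

Ltac zlookup t env :=
  lazymatch env with
  | @nil _ => constr:(@None nat)
  | cons ?a ?l =>
    match goal with
    | _ => let _ := match goal with _ => first [constr_eq t a | unify t a] end in constr:(Some O)
    | _ => lazymatch zlookup t l with
           | None => constr:(@None nat)
           | Some ?n => constr:(Some (S n)) end
    end
  end.

Ltac zatoms t env :=
  lazymatch t with
  | (?a + ?b)%R => let env := zatoms a env in zatoms b env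
  | (- ?a)%R => zatoms a env
  | (?a *+ ?n)%R => zatoms a env
  | 0%R => env
  | _ => lazymatch zlookup t env with
         | None => constr:(cons t env)
         | _ => env end
  end.

Ltac zreify t env :=
  lazymatch t with
  | (?a + ?b)%R => let a := zreify a env in let b := zreify b env in constr:(ZAdd a b)
  | (- ?a)%R => let a := zreify a env in constr:(ZOpp a)
  | (?a *+ ?n)%R => let a := zreify a env in constr:(ZMuln a n)
  | 0%R => constr:(ZZero)
  | _ => lazymatch zlookup t env with Some ?n => constr:(ZVar n) end
  end.

Ltac zmodule :=
  lazymatch goal with
  | |- @eq ?T ?a ?b =>
    let env := zatoms a (@nil T) in
    let env := zatoms b env in
    let a' := zreify a env in
    let b' := zreify b env in
    apply: (@zcheckP _ env a' b'); vm_compute; reflexivity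
  end.

(** * Tensor and symmetric powers *)

(* The witness is opaque, so that simplification never unfolds an additive map
   built by [mkadd]. *)
Lemma mkadd_subproof (U V : zmodType) (f : U -> V) (fB : zmod_morphism f) :
  {g : {additive U -> V} | g =1 f}.
Proof.
pose g : {additive U -> V} := HB.pack f (GRing.isZmodMorphism.Build U V f fB).
by exists g.
Qed.

Definition mkadd (U V : zmodType) (f : U -> V) (fB : zmod_morphism f) :
  {additive U -> V} := sval (mkadd_subproof fB).

Lemma mkaddE (U V : zmodType) (f : U -> V) (fB : zmod_morphism f) : mkadd fB =1 f.
Proof. exact: svalP (mkadd_subproof fB). Qed.

Lemma additive_eq (U V : zmodType) (f g : {additive U -> V}) : f =1 g -> f = g.
Proof.
case: f g => f [[fP]] [g [[gP]]] /= fg.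
have E : f = g by apply: funext.
subst g; by rewrite (Prop_irrelevance fP gP).
Qed.

Section QuotLift.
Variables (G M : zmodType) (H : zmodClosed G) (f : {additive G -> M}).
Hypothesis fH : forall x, x \in H -> f x = 0.

Definition quot_lift_fun (x : Quotient.quot H) : M := f (repr x).

Lemma quot_lift_funE x : quot_lift_fun (\pi_(Quotient.quot H) x) = f x.
Proof.
apply/eqP; rewrite -subr_eq0 -raddfB; apply/eqP/fH.
by apply/quot_eqP; rewrite reprK.
Qed.

Lemma quot_lift_is_zmod_morphism : zmod_morphism quot_lift_fun.
Proof.
move=> x y; rewrite -[x]reprK -[y]reprK -(raddfB (\pi_(Quotient.quot H))).
by rewrite !quot_lift_funE raddfB.
Qed.

Definition quot_lift : {additive Quotient.quot H -> M} := mkadd quot_lift_is_zmod_morphism.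

Lemma quot_liftE x : quot_lift (\pi_(Quotient.quot H) x) = f x.
Proof. by rewrite mkaddE quot_lift_funE. Qed.

End QuotLift.
Arguments quot_lift {G M} H f fH.

Lemma gen_sub_ker (G M : zmodType) (A : G -> Prop) (f : {additive G -> M}) :
  (forall a, A a -> f a = 0) -> forall x, x \in gen_sub A -> f x = 0.
Proof.
move=> fA x xA; pose P : {pred G} := fun x => f x == 0.
have PP : zmod_closed P.
  by split=> [|y z /eqP fy /eqP fz]; rewrite unfold_in /P ?raddf0 // raddfB fy fz subrr.
pose PB := GRing.isZmodClosed.Build G P PP.
pose PC : zmodClosed G := HB.pack P PB.
by apply/eqP; apply: (gen_sub_min (H := PC) _ xA) => a /fA /eqP.
Qed.

Lemma subgp_val_is_zmod_morphism (G : zmodType) (H : zmodClosed G) :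
  zmod_morphism (@subgp_val G H).
Proof. by []. Qed.

HB.instance Definition _ (G : zmodType) (H : zmodClosed G) :=
  GRing.isZmodMorphism.Build (subgp H) G (@subgp_val G H)
    (@subgp_val_is_zmod_morphism G H).

Section SubgpVal.
Variables (G : zmodType) (H : zmodClosed G).

Lemma subgp_valB (x y : subgp H) : subgp_val (x - y) = subgp_val x - subgp_val y.
Proof. by rewrite raddfB. Qed.

Lemma subgp_valD (x y : subgp H) : subgp_val (x + y) = subgp_val x + subgp_val y.
Proof. by rewrite raddfD. Qed.

Lemma subgp_valMn (x : subgp H) n : subgp_val (x *+ n) = subgp_val x *+ n.
Proof. by rewrite raddfMn. Qed.

End SubgpVal.

Section TensorPower.
Variables (d : nat) (V : zmodType).

Definition multilinear (M : zmodType) (h : {ffun 'I_d -> V} -> M) :=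
  forall v i x y, h (subst_arg v i (x + y)) = h (subst_arg v i x) + h (subst_arg v i y).

Lemma pure_tensor_multilinear : multilinear (@pure_tensor d V).
Proof.
move=> v i x y; rewrite /pure_tensor -raddfD; apply/quot_eqP.
by rewrite opprD addrA; apply: mem_gen_sub.
Qed.

Section Lift.
Variables (M : zmodType) (h : {ffun 'I_d -> V} -> M) (hM : multilinear h).

Lemma tlift_subproof x : x \in gen_sub (@multilinear_relator V d) -> free_lift h x = 0.
Proof.
apply: gen_sub_ker => _ [v i x1 x2].
by rewrite !raddfB /= !free_liftE hM addrAC addrK subrr.
Qed.

Definition tlift : {additive tpow d V -> M} := quot_lift _ _ tlift_subproof.

Lemma tliftE v : tlift (pure_tensor v) = h v.
Proof. by rewrite /tlift quot_liftE /= free_liftE. Qed.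

End Lift.

(** The elements satisfying [P] form a subgroup, and the projection modulo it agrees with the zero
    map on pure tensors, hence everywhere. *)
Lemma tpow_ind (P : tpow d V -> Prop) :
  P 0 -> (forall x y, P x -> P y -> P (x - y)) -> (forall v, P (pure_tensor v)) ->
  forall t, P t.
Proof.
move=> P0 PB Pp t; pose Q : {pred tpow d V} := fun x => `[< P x >].
have QP : zmod_closed Q.
  split=> [|x y /asboolP Px /asboolP Py]; apply/asboolP => //; exact: PB.
pose QC : zmodClosed (tpow d V) := HB.pack Q (GRing.isZmodClosed.Build _ Q QP).
pose z : {additive tpow d V -> Quotient.quot QC} := \0.
have /quot_eqP : t = 0 %[mod Quotient.quot QC].
  rewrite raddf0; apply: (tpow_ext (f := \pi_(Quotient.quot QC)) (g := z)) => v /=.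
  by rewrite -[RHS](raddf0 \pi_(Quotient.quot QC)); apply/quot_eqP; rewrite subr0; apply/asboolP.
by rewrite subr0 => /asboolP.
Qed.

End TensorPower.
Arguments tlift {d V M h} hM.

Section SymPower.
Variables (d : nat) (V : zmodType).

Definition pure_sym (v : {ffun 'I_d -> V}) : spow d V := \pi_(spow d V) (pure_tensor v).

Lemma pi_spow_perm s t : \pi_(spow d V) (tpow_perm s t) = \pi_(spow d V) t.
Proof. by apply/quot_eqP; apply: mem_gen_sub. Qed.

Section Lift.
Variables (M : zmodType) (h : {ffun 'I_d -> V} -> M) (hM : multilinear h).
Hypothesis hS : forall (s : 'S_d) (v : {ffun 'I_d -> V}), h [ffun i => v (s i)] = h v.

Lemma slift_subproof t : t \in gen_sub (@sym_relator d V) -> tlift hM t = 0.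
Proof.
apply: gen_sub_ker => _ [s t']; rewrite raddfB; apply/eqP; rewrite subr_eq0; apply/eqP.
apply: (tpow_ext (f := tlift hM \o tpow_perm s) (g := tlift hM)) => v /=.
by rewrite tpow_permE !tliftE hS.
Qed.

Definition slift : {additive spow d V -> M} := quot_lift _ _ slift_subproof.

Lemma slift_pi t : slift (\pi_(spow d V) t) = tlift hM t.
Proof. by rewrite /slift quot_liftE. Qed.

Lemma sliftE v : slift (pure_sym v) = h v.
Proof. by rewrite slift_pi tliftE. Qed.

End Lift.

Lemma spow_ind (P : spow d V -> Prop) :
  P 0 -> (forall x y, P x -> P y -> P (x - y)) -> (forall v, P (pure_sym v)) ->
  forall s, P s.
Proof.
move=> P0 PB Pp s; rewrite -[s]reprK; move: (repr s); apply: tpow_ind => //.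
  by rewrite raddf0.
by move=> x y Px Py; rewrite raddfB; apply: PB.
Qed.

End SymPower.
Arguments slift {d V M h} hM hS.

Lemma spow_map_pure (d : nat) (V W : zmodType) (g : {additive V -> W}) v :
  spow_map d g (pure_sym v) = pure_sym [ffun i => g (v i)].
Proof. by rewrite spow_mapE tpow_mapE. Qed.

Lemma multilinear_prod (d : nat) (V : zmodType) (A : comPzRingType)
    (l : 'I_d -> {additive V -> A}) :
  multilinear (fun v : {ffun 'I_d -> V} => \prod_i l i (v i)).
Proof.
move=> v i x y.
have E z : \prod_j l j (subst_arg v i z j) = l i z * \prod_(j | j != i) l j (v j).
  rewrite (bigD1 i) //= ffunE eqxx; congr (_ * _).
  by apply: eq_bigr => j /negbTE ji; rewrite ffunE ji.
by rewrite !E raddfD mulrDl.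
Qed.

Lemma multilinear_sum (d : nat) (V M : zmodType) (I : finType) (P : pred I)
    (h : I -> {ffun 'I_d -> V} -> M) :
  (forall i, multilinear (h i)) -> multilinear (fun v => \sum_(i | P i) h i v).
Proof.
by move=> hM v i x y; rewrite -big_split; apply: eq_bigr => j _; rewrite hM.
Qed.

Definition t3 (T : Type) (x y z : T) : {ffun 'I_3 -> T} := [ffun i : 'I_3 => nth x [:: x; y; z] i].

Lemma ord3P (P : 'I_3 -> Prop) : P 0 -> P 1 -> P 2%:R -> forall i, P i.
Proof.
move=> P0 P1 P2 [[|[|[|//]]] lti].
- by rewrite (_ : Ordinal lti = 0) //; apply: val_inj.
- by rewrite (_ : Ordinal lti = 1) //; apply: val_inj.
- by rewrite (_ : Ordinal lti = 2%:R) //; apply: val_inj.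
Qed.

Lemma t3_eta (T : Type) (v : {ffun 'I_3 -> T}) : t3 (v 0) (v 1) (v 2%:R) = v.
Proof. by apply/ffunP; apply: ord3P; rewrite ffunE. Qed.

Lemma t3_map (T U : Type) (g : T -> U) x y z :
  [ffun i => g (t3 x y z i)] = t3 (g x) (g y) (g z).
Proof. by apply/ffunP; apply: ord3P; rewrite !ffunE. Qed.

Lemma prod_ord3 (A : pzSemiRingType) (F : 'I_3 -> A) :
  \prod_i F i = F 0 * F 1 * F 2%:R.
Proof.
rewrite !big_ord_recl big_ord0 mulr1 mulrA.
by congr (F _ * F _ * F _); apply: val_inj.
Qed.

Lemma sum_t3 (M : nmodType) (I : finType) (F : {ffun 'I_3 -> I} -> M) :
  \sum_f F f = \sum_i \sum_j \sum_k F (t3 i j k).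
Proof.
rewrite pair_bigA pair_bigA /= (reindex (fun p : I * I * I => t3 p.1.1 p.1.2 p.2)) /=.
  by [].
exists (fun f => (f 0, f 1, f 2%:R)) => [[[i j] k] _|f _]; first by rewrite !ffunE.
exact: t3_eta.
Qed.

Section Trilinear.
Variables (V M : zmodType) (h : {ffun 'I_3 -> V} -> M).

Lemma multilinear3 :
  (forall x x' y z, h (t3 (x + x') y z) = h (t3 x y z) + h (t3 x' y z)) ->
  (forall x y y' z, h (t3 x (y + y') z) = h (t3 x y z) + h (t3 x y' z)) ->
  (forall x y z z', h (t3 x y (z + z')) = h (t3 x y z) + h (t3 x y z')) ->
  multilinear h.
Proof.
move=> h1 h2 h3 v i x y; rewrite -[v]t3_eta.
have E0 w a b c : subst_arg (t3 a b c) 0 w = t3 w b c :> {ffun 'I_3 -> V}.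
  by apply/ffunP; apply: ord3P; rewrite !ffunE.
have E1 w a b c : subst_arg (t3 a b c) 1 w = t3 a w c :> {ffun 'I_3 -> V}.
  by apply/ffunP; apply: ord3P; rewrite !ffunE.
have E2 w a b c : subst_arg (t3 a b c) 2%:R w = t3 a b w :> {ffun 'I_3 -> V}.
  by apply/ffunP; apply: ord3P; rewrite !ffunE.
by elim/ord3P: i; rewrite ?E0 ?E1 ?E2.
Qed.

Hypothesis hM : multilinear h.

Lemma trilinear1 y z : zmod_morphism (fun x => h (t3 x y z)).
Proof.
move=> x x' /=.
have E w : subst_arg (t3 0 y z) 0 w = t3 w y z.
  by apply/ffunP; apply: ord3P; rewrite !ffunE.
by have := hM (t3 0 y z) 0 (x - x') x'; rewrite !E subrK => ->; rewrite addrK.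
Qed.

Lemma trilinear2 x z : zmod_morphism (fun y => h (t3 x y z)).
Proof.
move=> y y' /=.
have E w : subst_arg (t3 x 0 z) 1 w = t3 x w z.
  by apply/ffunP; apply: ord3P; rewrite !ffunE.
by have := hM (t3 x 0 z) 1 (y - y') y'; rewrite !E subrK => ->; rewrite addrK.
Qed.

Lemma trilinear3 x y : zmod_morphism (fun z => h (t3 x y z)).
Proof.
move=> z z' /=.
have E w : subst_arg (t3 x y 0) 2%:R w = t3 x y w.
  by apply/ffunP; apply: ord3P; rewrite !ffunE.
by have := hM (t3 x y 0) 2%:R (z - z') z'; rewrite !E subrK => ->; rewrite addrK.
Qed.

Lemma trilinear_expand (I : finType) (b : I -> V) (x y z : I -> int) :
  h (t3 (\sum_i b i *~ x i) (\sum_i b i *~ y i) (\sum_i b i *~ z i)) =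
  \sum_(f : {ffun 'I_3 -> I}) h [ffun k => b (f k)] *~ (x (f 0) * y (f 1) * z (f 2%:R)).
Proof.
set X := \sum_i _; set Y := \sum_i _; set Z := \sum_i _.
transitivity (\sum_i \sum_j \sum_k h (t3 (b i) (b j) (b k)) *~ (x i * y j * z k)).
  rewrite -[LHS](mkaddE (trilinear1 Y Z)) raddf_sum; apply: eq_bigr => i _.
  rewrite raddfMz mkaddE -[h _](mkaddE (trilinear2 (b i) Z)) raddf_sum mulrz_suml.
  apply: eq_bigr => j _.
  rewrite raddfMz mkaddE -[h _](mkaddE (trilinear3 (b i) (b j))) raddf_sum !mulrz_suml.
  apply: eq_bigr => k _.
  by rewrite raddfMz mkaddE -!mulrzA; congr (_ *~ _); rewrite mulrC [y j * _]mulrC.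
rewrite sum_t3; apply: eq_bigr => i _; apply: eq_bigr => j _; apply: eq_bigr => k _.
by rewrite t3_map !ffunE.
Qed.

End Trilinear.

(** * Coordinates on the tensor cube and on the symmetric cube *)

Section Coordinates.
Variables (V : zmodType) (I : finType) (c : I -> {additive V -> int}) (b : I -> V).
Hypothesis cb : forall v, v = \sum_i b i *~ c i v.

Lemma multilinear3_expand (M : zmodType) (h : {ffun 'I_3 -> V} -> M) v :
  multilinear h ->
  h v = \sum_(f : {ffun 'I_3 -> I}) h [ffun k => b (f k)] *~ \prod_k c (f k) (v k).
Proof.
move=> hM; rewrite -{1}[v]t3_eta [v 0]cb [v 1]cb [v 2%:R]cb trilinear_expand //.
by apply: eq_bigr => f _; rewrite prod_ord3.
Qed.

Definition tcoord (f : {ffun 'I_3 -> I}) : {additive tpow 3 V -> int} :=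
  tlift (multilinear_prod (fun k => c (f k))).

Lemma tpow_expand t :
  t = \sum_(f : {ffun 'I_3 -> I}) pure_tensor [ffun k => b (f k)] *~ tcoord f t.
Proof.
elim/tpow_ind: t => [|x y Ex Ey|v].
- by rewrite big1 // => f _; rewrite raddf0.
- by rewrite {1}Ex {1}Ey -sumrB; apply: eq_bigr => f _; rewrite raddfB mulrzBr.
rewrite [LHS](multilinear3_expand _ (@pure_tensor_multilinear _ _)).
by apply: eq_bigr => f _; rewrite /tcoord tliftE.
Qed.

Lemma tcoord_perm (f : {ffun 'I_3 -> I}) (s : 'S_3) t :
  tcoord [ffun k => f (s k)] (tpow_perm s t) = tcoord f t.
Proof.
elim/tpow_ind: t => [|x y Ex Ey|v]; first by rewrite !raddf0.
  by rewrite !raddfB Ex Ey.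
rewrite tpow_permE /tcoord !tliftE [RHS](reindex_inj (@perm_inj _ s)).
by apply: eq_bigr => k _; rewrite !ffunE.
Qed.

(** A monomial of degree 3 in the [b i] is encoded as an orbit of index functions under the
    permutations of the three places; no order on [I] has to be chosen. *)
Definition orb (f : {ffun 'I_3 -> I}) : {set {ffun 'I_3 -> I}} :=
  [set g | [exists s : 'S_3, g == [ffun k => f (s k)]]].

Lemma orbP (f g : {ffun 'I_3 -> I}) : reflect (exists s : 'S_3, g = [ffun k => f (s k)]) (g \in orb f).
Proof. by rewrite inE; apply: (iffP existsP) => -[s /eqP]; exists s => //; apply/eqP. Qed.

Lemma orb_refl f : f \in orb f.
Proof. by apply/orbP; exists 1%g; apply/ffunP => k; rewrite ffunE perm1. Qed.

Lemma orb_perm (f : {ffun 'I_3 -> I}) (s : 'S_3) : orb [ffun k => f (s k)] = orb f.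
Proof.
apply/setP => g; apply/orbP/orbP => -[u ->].
  by exists (u * s)%g; apply/ffunP => k; rewrite !ffunE permM.
by exists (u * s^-1)%g; apply/ffunP => k; rewrite !ffunE permM permKV.
Qed.

(** The coefficient of the monomial [O] in the product of the three vectors [v k]. *)
Definition scoord_fun (O : {set {ffun 'I_3 -> I}}) (v : {ffun 'I_3 -> V}) : int :=
  \sum_(f | orb f == O) \prod_k c (f k) (v k).

Lemma scoord_multilinear O : multilinear (scoord_fun O).
Proof.
exact: (@multilinear_sum 3 V int _ (fun f => orb f == O)
          (fun f v => \prod_k c (f k) (v k)) (fun f => multilinear_prod (fun k => c (f k)))).
Qed.

Lemma scoord_sym O (s : 'S_3) (v : {ffun 'I_3 -> V}) :
  scoord_fun O [ffun i => v (s i)] = scoord_fun O v.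
Proof.
rewrite /scoord_fun.
rewrite (reindex (fun f : {ffun 'I_3 -> I} => [ffun k => f (s k)] : {ffun 'I_3 -> I})) /=.
  apply: eq_big => f; first by rewrite orb_perm.
  move=> _; rewrite [RHS](reindex_inj (@perm_inj _ s)).
  by apply: eq_bigr => k _; rewrite !ffunE.
exists (fun f => [ffun k => f (s^-1 k)%g]) => f _; apply/ffunP => k; rewrite !ffunE.
  by rewrite permKV.
by rewrite permK.
Qed.

Definition scoord O : {additive spow 3 V -> int} :=
  slift (scoord_multilinear O) (@scoord_sym O).

(** Sums over monomials run over all sets of index functions; those that are not orbits receive the
    default value 0. *)
Definition orb_monomial (O : {set {ffun 'I_3 -> I}}) : spow 3 V :=
  if [pick f | orb f == O] is Some f then pure_sym [ffun k => b (f k)] else 0.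

Lemma orb_monomialE (f : {ffun 'I_3 -> I}) : orb_monomial (orb f) = pure_sym [ffun k => b (f k)].
Proof.
rewrite /orb_monomial; case: pickP => [g /eqP gf|/(_ f)]; last by rewrite eqxx.
have /orbP[s ->] : g \in orb f by rewrite -gf orb_refl.
rewrite /pure_sym -[RHS](pi_spow_perm s) tpow_permE; congr (\pi_ _ (pure_tensor _)).
by apply/ffunP => k; rewrite !ffunE.
Qed.

Lemma spow_expand s : s = \sum_O orb_monomial O *~ scoord O s.
Proof.
elim/spow_ind: s => [|x y Ex Ey|v].
- by rewrite big1 // => f _; rewrite raddf0.
- by rewrite {1}Ex {1}Ey -sumrB; apply: eq_bigr => f _; rewrite raddfB mulrzBr.
have piM : multilinear (@pure_sym 3 V).
  by move=> w i x y; rewrite /pure_sym pure_tensor_multilinear raddfD.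
rewrite [LHS](multilinear3_expand _ piM) (partition_big orb predT) //=.
apply: eq_bigr => O _; rewrite /scoord sliftE /scoord_fun mulrz_sumr.
by apply: eq_bigr => f /eqP <-; rewrite orb_monomialE.
Qed.

Lemma scoord_eq0 (s : spow 3 V) : (forall O, scoord O s = 0) -> s = 0.
Proof. by move=> s0; rewrite [s]spow_expand big1 // => O _; rewrite s0. Qed.

Lemma spow_torsion_free (s : spow 3 V) m : s *+ m.+1 = 0 -> s = 0.
Proof.
move=> sm; apply: scoord_eq0 => O; apply/eqP.
have : scoord O s *+ m.+1 == 0 by rewrite -raddfMn sm raddf0.
by rewrite Num.Theory.mulrn_eq0.
Qed.

(* A monomial of degree 3 involves at most 3 coordinates. *)
Lemma spow_eq0_proj (p : I -> {additive V -> V}) (s : spow 3 V) :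
  (3 < #|I|)%N -> (forall i j v, j != i -> c j (p i v) = c j v) ->
  (forall i, spow_map 3 (p i) s = 0) -> s = 0.
Proof.
move=> gt3 cp ps; apply: scoord_eq0 => O.
(* If [O] is not an orbit, its coordinate is an empty sum. *)
case: (pickP [pred f | orb f == O]) => [f /= /eqP fO|noO]; last first.
  elim/spow_ind: s {ps} => [|x y Ex Ey|v]; first by rewrite raddf0.
    by rewrite raddfB Ex Ey subrr.
  by rewrite /scoord sliftE /scoord_fun big_pred0.
(* By cardinality some index [i] is missed by [f], hence by every index function in its orbit; [p i]
   preserves all the coordinates that remain, so it preserves the coefficient of [O]. *)
have [i iNf] : exists i, i \notin codom f.
  apply/existsP; apply: contraLR gt3 => /existsPn sub; rewrite -leqNgt.
  rewrite -[X in (_ <= X)%N](card_ord 3).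
  apply: leq_trans (leq_image_card f 'I_3); apply: subset_leq_card.
  apply/subsetP => i _; move: (sub i); rewrite negbK => /codomP[k ->].
  exact: image_f.
suff E : scoord O (spow_map 3 (p i) s) = scoord O s by rewrite -E ps raddf0.
elim/spow_ind: s {ps} => [|x y Ex Ey|v]; first by rewrite !raddf0.
  by rewrite !raddfB Ex Ey.
rewrite spow_map_pure /scoord !sliftE; apply: eq_bigr => g /eqP gO.
have /orbP[u gE] : g \in orb f by rewrite fO -gO orb_refl.
apply: eq_bigr => k _; rewrite ffunE; apply: cp.
by apply: contra iNf => /eqP <-; rewrite gE ffunE codom_f.
Qed.

End Coordinates.

Section RowCoord.
Variable n : nat.

Lemma row_coord_is_zmod_morphism i : zmod_morphism (fun v : 'rV[int]_n => v 0 i).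
Proof. by move=> x y; rewrite !mxE. Qed.

Definition row_coord i : {additive 'rV[int]_n -> int} :=
  mkadd (row_coord_is_zmod_morphism i).

Lemma row_coordP v : v = \sum_i delta_mx 0 i *~ row_coord i v.
Proof.
rewrite {1}[v]row_sum_delta; apply: eq_bigr => i _.
by rewrite mkaddE -scaler_int intz.
Qed.

End RowCoord.

Lemma fgfree_dual_basis (V : fgfree) :
  exists (n : nat) (c : 'I_n -> {additive V -> int}) (b : 'I_n -> V),
    forall v, v = \sum_i b i *~ c i v.
Proof.
have [n [e [e' eK e'K]]] := fgfree_basis V.
have e'B : zmod_morphism e'.
  by move=> x y; apply: (can_inj eK); rewrite e'K raddfB !e'K.
exists n, (fun i => row_coord i \o mkadd e'B), (fun i => e (delta_mx 0 i)) => v.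
rewrite -{1}[v]e'K {1}[e' v]row_coordP raddf_sum; apply: eq_bigr => i _.
by rewrite raddfMz -[e' v](mkaddE e'B).
Qed.

Lemma spow3_torsion_free (V : fgfree) (s : spow 3 V) m : s *+ m.+1 = 0 -> s = 0.
Proof. by have [n [c [b cb]]] := fgfree_dual_basis V; apply: (spow_torsion_free cb). Qed.

(** * Divided cubes *)

Section Tri.
Variable V : zmodType.
Implicit Types x y z : V.

Definition tri x y z : tpow 3 V := pure_tensor (t3 x y z).

Lemma tri_multilinear : multilinear (@pure_tensor 3 V).
Proof. exact: pure_tensor_multilinear. Qed.

Lemma triDl x x' y z : tri (x + x') y z = tri x y z + tri x' y z.
Proof.
rewrite -[LHS](mkaddE (trilinear1 tri_multilinear y z)) raddfD.
by rewrite !(mkaddE (trilinear1 tri_multilinear y z)).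
Qed.

Lemma triDm x y y' z : tri x (y + y') z = tri x y z + tri x y' z.
Proof.
rewrite -[LHS](mkaddE (trilinear2 tri_multilinear x z)) raddfD.
by rewrite !(mkaddE (trilinear2 tri_multilinear x z)).
Qed.

Lemma triDr x y z z' : tri x y (z + z') = tri x y z + tri x y z'.
Proof.
rewrite -[LHS](mkaddE (trilinear3 tri_multilinear x y)) raddfD.
by rewrite !(mkaddE (trilinear3 tri_multilinear x y)).
Qed.

Lemma tri0l y z : tri 0 y z = 0.
Proof. by rewrite -[LHS](mkaddE (trilinear1 tri_multilinear y z)) raddf0. Qed.

Lemma tri0m x z : tri x 0 z = 0.
Proof. by rewrite -[LHS](mkaddE (trilinear2 tri_multilinear x z)) raddf0. Qed.

Lemma tri0r x y : tri x y 0 = 0.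
Proof. by rewrite -[LHS](mkaddE (trilinear3 tri_multilinear x y)) raddf0. Qed.

Definition triD := (triDl, triDm, triDr).
Definition tri0 := (tri0l, tri0m, tri0r).

Lemma perm3_01 (T : Type) (x y z : T) :
  [ffun k => t3 x y z (tperm 0 1 k)] = t3 y x z :> {ffun 'I_3 -> T}.
Proof. by apply/ffunP; apply: ord3P; rewrite !ffunE permE. Qed.

Lemma perm3_12 (T : Type) (x y z : T) :
  [ffun k => t3 x y z (tperm 1 2%:R k)] = t3 x z y :> {ffun 'I_3 -> T}.
Proof. by apply/ffunP; apply: ord3P; rewrite !ffunE permE. Qed.

Lemma tri_perm01 x y z : tpow_perm (tperm 0 1) (tri x y z) = tri y x z.
Proof. by rewrite tpow_permE perm3_01. Qed.

Lemma tri_perm12 x y z : tpow_perm (tperm 1 2%:R) (tri x y z) = tri x z y.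
Proof. by rewrite tpow_permE perm3_12. Qed.

Lemma gpow_perm (g : gpow 3 V) s : tpow_perm s (subgp_val g) = subgp_val g.
Proof. by apply/eqP; move/forallP: (subgp_valP g). Qed.

(** The six permutations are written as words in two adjacent transpositions, so that the norm of a
    pure tensor is evaluated by rewriting. *)
Definition norm3 (t : tpow 3 V) : tpow 3 V :=
  let p01 := tpow_perm (tperm 0 1) in let p12 := tpow_perm (tperm 1 2%:R) in
  t + p01 t + p12 t + p01 (p12 t) + p12 (p01 t) + p12 (p01 (p12 t)).

Lemma norm3_tri x y z : norm3 (tri x y z) =
  tri x y z + tri y x z + tri x z y + tri z x y + tri y z x + tri z y x.
Proof. by rewrite /norm3 /= !(tri_perm01, tri_perm12). Qed.

Lemma norm3_gpow (g : gpow 3 V) : norm3 (subgp_val g) = subgp_val g *+ 6.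
Proof. by rewrite /norm3 /= !gpow_perm; zmodule. Qed.

Lemma norm3_is_zmod_morphism : zmod_morphism norm3.
Proof. by move=> t u; rewrite /norm3 /= !raddfB; zmodule. Qed.

Lemma g3_subproof x : tri x x x \in @sym_tensor 3 V.
Proof.
have E i : t3 x x x i = x by elim/ord3P: i; rewrite ffunE.
apply/forallP => s; rewrite tpow_permE; apply/eqP; congr pure_tensor.
by apply/ffunP => k; rewrite ffunE !E.
Qed.

(** The divided power gamma_3(x). *)
Definition g3 x : gpow 3 V := Subgp (g3_subproof x).

Lemma g21_subproof x y : tri x x y + tri x y x + tri y x x \in @sym_tensor 3 V.
Proof.
have -> : tri x x y + tri x y x + tri y x x =
    (* Indexing the three terms by the position of [y] turns the action of a permutation into a
       reindexing of the sum. *)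
    \sum_(i : 'I_3) pure_tensor [ffun k => if k == i then y else x].
  rewrite !big_ord_recr big_ord0 /= add0r addrC addrA addrAC.
  by do ?congr (_ + _); congr pure_tensor; apply/ffunP; apply: ord3P; rewrite !ffunE.
apply/forallP => s; rewrite raddf_sum /=; apply/eqP.
rewrite (reindex_inj (@perm_inj _ s)) /=; apply: eq_bigr => i _.
rewrite tpow_permE; congr pure_tensor; apply/ffunP => k; rewrite !ffunE.
by rewrite (inj_eq perm_inj).
Qed.

(** The product gamma_2(x) y in the divided power algebra. *)
Definition g21 x y : gpow 3 V := Subgp (g21_subproof x y).

(* The polarisation of [g21] is the orbit sum of a general pure tensor. *)
Lemma g21_polar x y z :
  subgp_val (g21 (x + y) z - g21 x z - g21 y z) = norm3 (tri x y z).
Proof. by rewrite norm3_tri /= !triD; zmodule. Qed.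

End Tri.

Section MapTri.
Variables (V W : zmodType) (f : {additive V -> W}).

Lemma tpow_map_tri x y z : tpow_map 3 f (tri x y z) = tri (f x) (f y) (f z).
Proof. by rewrite tpow_mapE t3_map. Qed.

Lemma gpow_map_g3 x : gpow_map 3 f (g3 x) = g3 (f x).
Proof. by apply: val_inj; rewrite /= tpow_map_tri. Qed.

Lemma gpow_map_g21 x y : gpow_map 3 f (g21 x y) = g21 (f x) (f y).
Proof. by apply: val_inj; rewrite /= !raddfD /= !tpow_map_tri. Qed.

End MapTri.

Section SumMem.
Variables (M : zmodType) (P : M -> Prop) (I : Type).
Hypotheses (P0 : P 0) (PD : forall x y, P x -> P y -> P (x + y)).

Lemma sum2_mem (s : seq I) (G : I -> I -> M) :
  (forall i, P (G i i)) -> (forall i j, P (G i j + G j i)) ->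
  P (\sum_(i <- s) \sum_(j <- s) G i j).
Proof.
move=> G1 G2; elim: s => [|a s IH]; first by rewrite big_nil.
rewrite big_cons; under eq_bigr => i _ do rewrite big_cons.
rewrite big_cons big_split /= addrA -[X in X + _]addrA -big_split /=.
do 2!apply: PD => //; elim/big_ind: _ => //.
Qed.

(** Induction on [s]: the terms with the head in exactly two places form a single sum of blocks of
    the second kind, and those with the head in one place form a double sum, to which [sum2_mem]
    applies. This groups the expansion of an invariant tensor into orbit sums. *)
Lemma sum3_mem (s : seq I) (F : I -> I -> I -> M) :
  (forall i, P (F i i i)) ->
  (forall i j, P (F i i j + F i j i + F j i i)) ->
  (forall i j k, P (F i j k + F j i k + F i k j + F k i j + F j k i + F k j i)) ->
  P (\sum_(i <- s) \sum_(j <- s) \sum_(k <- s) F i j k).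
Proof.
move=> F1 F2 F3; elim: s => [|a s IH]; first by rewrite big_nil.
have E i : \sum_(j <- a :: s) \sum_(k <- a :: s) F i j k =
    F i a a + \sum_(k <- s) (F i a k + F i k a) + \sum_(j <- s) \sum_(k <- s) F i j k.
  rewrite big_cons; under eq_bigr => j _ do rewrite big_cons.
  by rewrite big_cons !big_split /= !addrA.
rewrite big_cons E; under eq_bigr => i _ do rewrite E.
rewrite !big_split /=.
pose G i j := F a i j + F i a j + F i j a.
have PG : P (\sum_(i <- s) \sum_(j <- s) G i j).
  apply: sum2_mem => [i|i j]; rewrite /G.
    by have := F2 i a; congr P; zmodule.
  by have := F3 a i j; congr P; zmodule.
have PG' : P (\sum_(i <- s) (F i a a + F a i a + F a a i)).
  elim/big_ind: _ => // i _; by have := F2 a i; congr P; zmodule.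
have := PD (PD (F1 a) PG') (PD PG IH); congr P.
have -> : \sum_(i <- s) \sum_(j <- s) G i j = \sum_(i <- s) \sum_(j <- s) F a i j +
    \sum_(i <- s) \sum_(j <- s) (F i a j + F i j a).
  rewrite -big_split; apply: eq_bigr => i _; rewrite -big_split.
  by apply: eq_bigr => j _; rewrite /G /= addrA.
rewrite !big_split /=; zmodule.
Qed.

End SumMem.

(** Gamma^3 is generated by the elements gamma_3(v) and gamma_2(x) y: an invariant tensor has
    coefficients symmetric in the three indices, so its expansion is a combination of orbit sums,
    and the orbit sum on three indices is a polarisation of [g21]. *)
Lemma gpow3_ind (V : fgfree) (P : gpow 3 V -> Prop) :
  P 0 -> (forall x y, P x -> P y -> P (x - y)) -> (forall v, P (g3 v)) ->
  (forall x y, P (g21 x y)) -> forall g, P g.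
Proof.
move=> P0 PB P3 P21 g; have [n [c [b cb]]] := fgfree_dual_basis V.
have PN x : P x -> P (- x) by move=> Px; rewrite -[- x]sub0r; apply: PB.
have PD x y : P x -> P y -> P (x + y).
  by move=> Px Py; rewrite -[y]opprK; apply: PB => //; apply: PN.
have PZ x m : P x -> P (x *~ m).
  move=> Px; have Pn k : P (x *+ k).
    by elim: k => [|k IH]; rewrite ?mulr0n // mulrS; apply: PD.
  by case: m => k; [apply: Pn | rewrite NegzE mulrNz; apply/PN/Pn].
(* The single terms of the expansion are not invariant, so the property is stated for tensors: being
   the value of an invariant element that satisfies [P]. *)
pose Q t := exists2 g', subgp_val g' = t & P g'.
suff [g' /val_inj-> //] : Q (subgp_val g).
pose a i j k := tcoord c (t3 i j k) (subgp_val g).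
have a01 i j k : a j i k = a i j k.
  by rewrite /a -(tcoord_perm _ (t3 i j k) (tperm 0 1)) perm3_01 gpow_perm.
have a12 i j k : a i k j = a i j k.
  by rewrite /a -(tcoord_perm _ (t3 i j k) (tperm 1 2%:R)) perm3_12 gpow_perm.
rewrite [subgp_val g](tpow_expand cb) sum_t3.
pose F i j k := tri (b i) (b j) (b k) *~ a i j k.
under eq_bigr => i _ do under eq_bigr => j _ do under eq_bigr => k _ do
  rewrite t3_map -/(tri _ _ _) -/(a i j k) -/(F i j k).
apply: sum3_mem; first by exists 0.
- by move=> _ _ [x <- Px] [y <- Py]; exists (x + y); rewrite ?raddfD //; apply: PD.
- by move=> i; exists (g3 (b i) *~ a i i i); [rewrite raddfMz | exact: PZ].
- move=> i j; exists (g21 (b i) (b j) *~ a i i j); last exact: PZ.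
  by rewrite raddfMz /= !mulrzDl /F (a01 i j i) (a12 i i j).
- move=> i j k.
  exists ((g21 (b i + b j) (b k) - g21 (b i) (b k) - g21 (b j) (b k)) *~ a i j k).
    rewrite raddfMz [X in X *~ _]g21_polar norm3_tri !mulrzDl /F.
    by rewrite (a01 j k i) (a12 j i k) (a01 i j k) (a01 i k j) (a12 i j k).
  by apply/PZ/PB => //; apply: PB.
Qed.

(** * The natural retraction of an extension *)

Lemma gpow_inj d (V : zmodType) (g h : gpow d V) : subgp_val g = subgp_val h -> g = h.
Proof. exact: val_inj. Qed.

Section Row.
Variable n : nat.

Lemma row_fgfree : exists (m : nat) (e : {additive 'rV[int]_m -> 'rV[int]_n}), bijective e.
Proof. by exists n, idfun; exists id. Qed.

Definition rowf : fgfree := FgFree row_fgfree.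

Definition dx (i : 'I_n) : rowf := delta_mx 0 i : 'rV[int]_n.

Section Lin.
Variables (V : zmodType) (v : 'I_n -> V).

Lemma lin_is_zmod_morphism : zmod_morphism (fun r : rowf => \sum_i v i *~ row_coord i r).
Proof.
move=> r s; rewrite -sumrB; apply: eq_bigr => i _.
by rewrite raddfB mulrzBr.
Qed.

(** Z^n with its basis [dx] is the universal module with n chosen vectors: a natural identity is
    checked on the basis and transported along [lin]. *)
Definition lin : {additive rowf -> V} := mkadd lin_is_zmod_morphism.

Lemma lin_dx i : lin (dx i) = v i.
Proof.
rewrite mkaddE (bigD1 i) //= big1 => [|j ji]; rewrite mkaddE mxE eqxx.
  by rewrite eqxx addr0.
by rewrite (negbTE ji).
Qed.

End Lin.

Lemma lin_comp (V W : zmodType) (f : {additive V -> W}) (v : 'I_n -> V) :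
  f \o lin v = lin (f \o v) :> {additive _ -> _}.
Proof.
apply: additive_eq => r; rewrite /= !mkaddE raddf_sum.
by apply: eq_bigr => i _; rewrite raddfMz.
Qed.

Lemma kill_is_zmod_morphism (i : 'I_n) :
  zmod_morphism (fun r : rowf => \row_j (if j == i then 0 else (r : 'rV[int]_n) 0 j) : rowf).
Proof.
move=> r s; apply/rowP => j; rewrite !mxE; by case: eqP.
Qed.

Definition kill i : {additive rowf -> rowf} := mkadd (kill_is_zmod_morphism i).

Lemma kill_coord i j r : j != i -> row_coord j (kill i r) = row_coord j r.
Proof. by move=> /negbTE ji; rewrite /kill !mkaddE mxE ji. Qed.

Lemma kill_dx i : kill i (dx i) = 0.
Proof.
by rewrite mkaddE; apply/rowP => j; rewrite !mxE; case: eqP => // /eqP/negbTE ->; rewrite andbF.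
Qed.

End Row.

Section Cube.
Variables (E : extension (Gamma 3) (Sym 3)) (e : E (rowf 1)).
Hypothesis pr_e : ext_pr E (rowf 1) e = g3 (dx 0).

Section Obj.
Variable V : fgfree.
Implicit Types x y z : V.

(** The vector [x] is read as the map from Z to V that sends the generator to [x]. The lock makes
    the values of [ev] atoms for rewriting and for [zmodule]. *)
Definition ev x : E V := locked (fmap E (lin (fun _ => x)) e).

Lemma evE x : ev x = fmap E (lin (fun _ => x)) e.
Proof. by rewrite /ev -lock. Qed.

Lemma pr_ev x : ext_pr E V (ev x) = g3 x.
Proof. by rewrite evE nt_natural pr_e [LHS]gpow_map_g3 lin_dx. Qed.

(** The term [ev 0] makes the difference vanish identically when an argument is 0; that [ev 0]
    itself is 0 is known only later, by homogeneity. *)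
Definition cross3 x y z : E V :=
  locked (ev (x + y + z) - ev (x + y) - ev (x + z) - ev (y + z) + ev x + ev y + ev z - ev 0).

Lemma cross3E x y z : cross3 x y z =
  ev (x + y + z) - ev (x + y) - ev (x + z) - ev (y + z) + ev x + ev y + ev z - ev 0.
Proof. by rewrite /cross3 -lock. Qed.

Lemma cross3C x y z : cross3 x y z = cross3 y x z.
Proof. by rewrite !cross3E [y + x]addrC; zmodule. Qed.

Lemma cross3AC x y z : cross3 x y z = cross3 x z y.
Proof. by rewrite !cross3E [z + y]addrC [x + z + y]addrAC; zmodule. Qed.

Lemma cross3_0l y z : cross3 0 y z = 0.
Proof. by rewrite !cross3E !add0r; zmodule. Qed.

Lemma val_prB (a b : E V) : subgp_val (ext_pr E V (a - b)) =
  subgp_val (ext_pr E V a) - subgp_val (ext_pr E V b).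
Proof. by rewrite raddfB. Qed.

Lemma val_prD (a b : E V) : subgp_val (ext_pr E V (a + b)) =
  subgp_val (ext_pr E V a) + subgp_val (ext_pr E V b).
Proof. by rewrite raddfD. Qed.

Lemma pr_cross3 x y z : subgp_val (ext_pr E V (cross3 x y z)) = norm3 (tri x y z).
Proof.
by rewrite !cross3E !(val_prB, val_prD) !pr_ev norm3_tri /= !(triD, tri0); zmodule.
Qed.

End Obj.

Lemma fmap_ev (V W : fgfree) (f : {additive V -> W}) (x : V) : fmap E f (ev x) = ev (f x).
Proof. by rewrite !evE -[LHS]/((fmap E f \o fmap E _) e) -fmap_comp lin_comp. Qed.

Lemma fmap_cross3 (V W : fgfree) (f : {additive V -> W}) (x y z : V) :
  fmap E f (cross3 x y z) = cross3 (f x) (f y) (f z).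
Proof. by rewrite !cross3E !(raddfB, raddfD) !fmap_ev !raddfD raddf0. Qed.

Definition dev (V : fgfree) (x x' y z : V) : E V := cross3 (x + x') y z - cross3 x y z - cross3 x' y z.

(* The deviation lies in S^3 and is natural in its four arguments, so on the
   universal example Z^4 it is killed by every coordinate projection. *)
Lemma dev_dx : dev (dx 0 : rowf 4) (dx 1) (dx 2%:R) (dx 3%:R) = 0.
Proof.
have : ext_pr E (rowf 4) (dev (dx 0) (dx 1) (dx 2%:R) (dx 3%:R)) = 0.
  apply: gpow_inj; rewrite [RHS]raddf0 /dev !val_prB !pr_cross3 !norm3_tri !triD; zmodule.
move=> /ext_exact[s sE]; suff s0 : s = 0 by rewrite -sE s0 raddf0.
apply: (@spow_eq0_proj _ _ _ _ (@row_coordP 4) (@kill 4)) => [|i j v|i].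
- by rewrite card_ord.
- exact: kill_coord.
apply: (@ext_inj _ _ E (rowf 4)); rewrite raddf0.
have -> : spow_map 3 (kill i) s = fmap (Sym 3) (kill i) s by [].
rewrite nt_natural sE /dev !raddfB !fmap_cross3 raddfD.
(* Killing the i-th basis vector puts 0 in the i-th argument of [dev], and the deviation then
   cancels. *)
have [->|->|->|->] : [\/ i = 0, i = 1, i = 2%:R | i = 3%:R].
  case: i => [[|[|[|[|//]]]] lti]; [constructor 1|constructor 2|constructor 3|constructor 4];
  exact: val_inj.
- by rewrite kill_dx add0r cross3_0l; zmodule.
- by rewrite kill_dx addr0 cross3_0l; zmodule.
- by rewrite kill_dx ![cross3 _ 0 _]cross3C !cross3_0l; zmodule.
- by rewrite kill_dx ![cross3 _ _ 0]cross3AC ![cross3 _ 0 _]cross3C !cross3_0l; zmodule.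
Qed.

Lemma cross3Dl (V : fgfree) (x x' y z : V) : cross3 (x + x') y z = cross3 x y z + cross3 x' y z.
Proof.
apply/eqP; rewrite -subr_eq0 opprD addrA; apply/eqP.
have := congr1 (fmap E (lin (fun i : 'I_4 => nth 0 [:: x; x'; y; z] i))) dev_dx.
by rewrite raddf0 /dev !raddfB !fmap_cross3 raddfD !lin_dx.
Qed.

Section Lift.
Variable V : fgfree.

Definition cross3_fun (v : {ffun 'I_3 -> V}) : E V := cross3 (v 0) (v 1) (v 2%:R).

Lemma cross3_multilinear : multilinear cross3_fun.
Proof.
apply: multilinear3 => [x x' y z|x y y' z|x y z z']; rewrite /cross3_fun !ffunE /=.
- exact: cross3Dl.
- by rewrite cross3C cross3Dl ![cross3 _ x _]cross3C.
- by rewrite cross3AC cross3C cross3Dl ![cross3 _ x _]cross3C ![cross3 x _ y]cross3AC.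
Qed.

Definition tau : {additive tpow 3 V -> E V} := tlift cross3_multilinear.

Lemma tau_tri x y z : tau (tri x y z) = cross3 x y z.
Proof. by rewrite /tau tliftE /cross3_fun !ffunE. Qed.

Lemma pr_tau t : subgp_val (ext_pr E V (tau t)) = norm3 t.
Proof.
elim/tpow_ind: t => [|x y Ex Ey|v].
- by rewrite -[RHS](mkaddE (@norm3_is_zmod_morphism V)) !raddf0.
- rewrite raddfB val_prB Ex Ey -[RHS](mkaddE (@norm3_is_zmod_morphism V)).
  by rewrite raddfB !mkaddE.
by rewrite -[v]t3_eta -/(tri _ _ _) tau_tri pr_cross3.
Qed.

(** Both terms project to six times the image of [x]: for the second one, [tau] lifts the norm and
    the norm of an invariant tensor is six times that tensor. *)
Lemma ret_subproof (x : E V) :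
  exists b, ext_in E V b = x *+ 6 - tau (subgp_val (ext_pr E V x)).
Proof.
apply/ext_exact; apply: gpow_inj.
by rewrite val_prB pr_tau norm3_gpow (raddfMn (ext_pr E V)) raddfMn subrr.
Qed.

Definition ret_fun x := sval (cid (ret_subproof x)).

Lemma ret_funP x : ext_in E V (ret_fun x) = x *+ 6 - tau (subgp_val (ext_pr E V x)).
Proof. exact: svalP (cid (ret_subproof x)). Qed.

Lemma ret_is_zmod_morphism : zmod_morphism ret_fun.
Proof.
move=> x y; apply: (@ext_inj _ _ E V); rewrite raddfB !ret_funP !raddfB /=.
by rewrite mulrnBl; zmodule.
Qed.

Definition ret : {additive E V -> Sym 3 V} := mkadd ret_is_zmod_morphism.

Lemma retP x : ext_in E V (ret x) = x *+ 6 - tau (subgp_val (ext_pr E V x)).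
Proof. by rewrite mkaddE ret_funP. Qed.

Lemma ret_in b : ret (ext_in E V b) = b *+ 6.
Proof.
apply: (@ext_inj _ _ E V); rewrite retP (_ : ext_pr E V _ = 0).
  by rewrite !raddf0 addr0 raddfMn.
by apply/ext_exact; exists b.
Qed.

End Lift.

Lemma fmap_tau (V W : fgfree) (f : {additive V -> W}) t :
  fmap E f (tau V t) = tau W (tpow_map 3 f t).
Proof.
elim/tpow_ind: t => [|x y Ex Ey|v]; first by rewrite !raddf0.
  by rewrite !raddfB /= Ex Ey.
by rewrite -[v]t3_eta -/(tri _ _ _) tpow_map_tri !tau_tri fmap_cross3.
Qed.

Lemma ret_natural (V W : fgfree) (f : {additive V -> W}) x :
  ret W (fmap E f x) = spow_map 3 f (ret V x).
Proof.
apply: (@ext_inj _ _ E W); rewrite retP nt_natural.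
have -> : spow_map 3 f (ret V x) = fmap (Sym 3) f (ret V x) by [].
by rewrite nt_natural retP raddfB raddfMn fmap_tau.
Qed.

(* [ret e] may be any multiple of the generator a priori; that multiplication by
   2 and 3 act on [ret e] through their cubes forces it to vanish. *)
Lemma ev_scale (V : fgfree) (f : {additive V -> V}) (x : V) m :
  (forall s, spow_map 3 f s = s *+ m) -> g3 (f x) = g3 x *+ m -> ev (f x) = ev x *+ m.
Proof.
move=> fS fG; apply/eqP; rewrite -subr_eq0; apply/eqP.
have /ext_exact[b bE] : ext_pr E V (ev (f x) - ev x *+ m) = 0.
  by rewrite raddfB raddfMn !pr_ev fG subrr.
(* By naturality [ret] kills the defect [b], whereas on S^3 it is multiplication by 6; S^3 is
   torsion free. *)
have b0 : b *+ 6 = 0.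
  by rewrite -ret_in bE raddfB raddfMn -fmap_ev ret_natural fS subrr.
by rewrite -bE (spow3_torsion_free b0) raddf0.
Qed.

(** The third difference at (x, x, x) is ev(3x) - 3 ev(2x) + 3 ev(x) - ev(0). Cubic homogeneity
    under 0, 2 and 3 turns it into (27 - 24 + 3) ev(x) = 6 ev(x), which cancels the other term of
    [ret]. *)
Lemma ret_ev (V : fgfree) (x : V) : ret V (ev x) = 0.
Proof.
apply: (@ext_inj _ _ E V); rewrite retP pr_ev tau_tri raddf0 cross3E.
have scale (f : {additive V -> V}) m :
    (forall y z t, tri (f y) (f z) (f t) = tri y z t *+ m) -> ev (f x) = ev x *+ m.
  move=> fm; apply: ev_scale; last by apply: gpow_inj; rewrite /= fm raddfMn.
  elim/spow_ind => [|s s' Es Es'|v]; first by rewrite raddf0 mul0rn.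
    by rewrite raddfB /= Es Es' mulrnBl.
  rewrite spow_map_pure -[v]t3_eta t3_map; move: (v 0) (v 1) (v 2%:R) => y z t.
  by rewrite /pure_sym -!/(tri _ _ _) fm raddfMn.
have E0 : ev (0 : V) = 0.
  by rewrite -[LHS]/(ev ((\0 : {additive V -> V}) x)) (scale _ 0%N) // => y z t; rewrite /= tri0.
have E2 : ev (x + x) = ev x *+ 8.
  rewrite -[LHS]/(ev ((idfun \+ idfun : {additive V -> V}) x)); apply: scale => y z t /=.
  by rewrite !triD; zmodule.
have E3 : ev (x + x + x) = ev x *+ 27.
  rewrite -[LHS]/(ev ((idfun \+ idfun \+ idfun : {additive V -> V}) x)).
  by apply: scale => y z t /=; rewrite !triD; zmodule.
by rewrite E0 E2 E3; zmodule.
Qed.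

End Cube.

(** * Cubic forms in two variables and their parity *)

Section SymMul.
Variables (V : zmodType) (A : comPzRingType) (h : {additive V -> A}).

Lemma smul_subproof (s : 'S_3) (v : {ffun 'I_3 -> V}) :
  \prod_i h ([ffun i => v (s i)] i) = \prod_i h (v i).
Proof.
rewrite [RHS](reindex_inj (@perm_inj _ s)).
by apply: eq_bigr => i _; rewrite ffunE.
Qed.

Definition smul : {additive spow 3 V -> A} :=
  slift (multilinear_prod (fun _ => h)) smul_subproof.

Lemma smul_pure x y z : smul (pure_sym (t3 x y z)) = h x * h y * h z.
Proof. by rewrite /smul sliftE prod_ord3 !ffunE. Qed.

End SymMul.

Lemma pure_symC (V : zmodType) (x y z : V) : pure_sym (t3 x y z) = pure_sym (t3 y x z).
Proof.
by rewrite -perm3_01 /pure_sym -tpow_permE pi_spow_perm.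
Qed.

Lemma pure_symAC (V : zmodType) (x y z : V) : pure_sym (t3 x y z) = pure_sym (t3 x z y).
Proof.
by rewrite -perm3_12 /pure_sym -tpow_permE pi_spow_perm.
Qed.

Section Eps.

Lemma binary_form_is_zmod_morphism :
  zmod_morphism (fun v : rowf 2 => ((row_coord 0 v)%:~R)%:P + (row_coord 1 v)%:~R *: 'X : {poly 'Z_2}).
Proof.
by move=> v w; rewrite !raddfB /= !scalerBl; zmodule.
Qed.

Definition binary_form : {additive rowf 2 -> {poly 'Z_2}} :=
  mkadd binary_form_is_zmod_morphism.

Lemma binary_form_dx0 : binary_form (dx 0) = 1.
Proof. by rewrite mkaddE /row_coord !mkaddE !mxE /= scale0r addr0. Qed.

Lemma binary_form_dx1 : binary_form (dx 1) = 'X.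
Proof. by rewrite mkaddE /row_coord !mkaddE !mxE /= scale1r polyC0 add0r. Qed.

(* [eps] is the coefficient of x^2 y modulo 2, read off after the substitution
   x = 1, y = 'X. *)
Lemma eps_is_zmod_morphism : zmod_morphism (fun s => (smul binary_form s)`_1).
Proof. by move=> s t; rewrite raddfB coefB. Qed.

Definition eps : {additive spow 3 (rowf 2) -> 'Z_2} := mkadd eps_is_zmod_morphism.

Lemma eps_double s : eps (s *+ 2) = 0.
Proof. by rewrite raddfMn mulr2n; case: (eps s) => [[|[|]]] // ?; apply: val_inj. Qed.

Let x : rowf 2 := dx 0.
Let y : rowf 2 := dx 1.

Lemma eps_xxx : eps (pure_sym (t3 x x x)) = 0.
Proof. by rewrite mkaddE smul_pure binary_form_dx0 !mulr1 coef1. Qed.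

Lemma eps_xxy : eps (pure_sym (t3 x x y)) = 1.
Proof. by rewrite mkaddE smul_pure binary_form_dx0 binary_form_dx1 !mul1r coefX. Qed.

Lemma eps_xyy : eps (pure_sym (t3 x y y)) = 0.
Proof. by rewrite mkaddE smul_pure binary_form_dx0 binary_form_dx1 mul1r -expr2 coefXn. Qed.

Lemma eps_yyy : eps (pure_sym (t3 y y y)) = 0.
Proof. by rewrite mkaddE smul_pure binary_form_dx1 -expr2 -exprSr coefXn. Qed.

Lemma spow_row2_expand (r : spow 3 (rowf 2)) : exists a b c d : int,
  r = pure_sym (t3 x x x) *~ a + pure_sym (t3 x x y) *~ b +
      pure_sym (t3 x y y) *~ c + pure_sym (t3 y y y) *~ d.
Proof.
pose Q (r : spow 3 (rowf 2)) := exists a b c d : int,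
  r = pure_sym (t3 x x x) *~ a + pure_sym (t3 x x y) *~ b +
      pure_sym (t3 x y y) *~ c + pure_sym (t3 y y y) *~ d.
rewrite -/(Q r).
have Q0 : Q 0 by exists 0, 0, 0, 0; rewrite !mulr0z !addr0.
have QB r1 r2 : Q r1 -> Q r2 -> Q (r1 - r2).
  move=> [a [b [c [d ->]]]] [a' [b' [c' [d' ->]]]].
  by exists (a - a'), (b - b'), (c - c'), (d - d'); rewrite !mulrzBr; zmodule.
have QD r1 r2 : Q r1 -> Q r2 -> Q (r1 + r2).
  move=> Q1 Q2; rewrite -[r2]opprK -[- r2]sub0r.
  by apply: (QB _ _ Q1); apply: QB.
have QZ r1 m : Q r1 -> Q (r1 *~ m).
  move=> [a [b [c [d ->]]]]; exists (a * m), (b * m), (c * m), (d * m).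
  by rewrite !mulrzDl !mulrzA.
elim/spow_ind: r => // v.
have piM : multilinear (@pure_sym 3 (rowf 2)).
  by move=> w i p q; rewrite /pure_sym pure_tensor_multilinear raddfD.
rewrite (multilinear3_expand (@row_coordP 2) _ piM).
elim/big_ind: _ => // f _; apply: QZ.
have -> : [ffun k => delta_mx 0 (f k)] = t3 (dx (f 0)) (dx (f 1)) (dx (f 2%:R)) :> {ffun 'I_3 -> rowf 2}.
  by rewrite -[RHS]t3_eta; apply/ffunP; apply: ord3P; rewrite !ffunE.
have I2 (i : 'I_2) : i = 0 \/ i = 1.
  by case: i => [[|[|//]] lti]; [left|right]; apply: val_inj.
case: (I2 (f 0)) (I2 (f 1)) (I2 (f 2%:R)) => [] -> [] -> [] ->; rewrite -?/x -?/y.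
- by exists 1, 0, 0, 0; rewrite !mulr0z mulr1z !addr0.
- by exists 0, 1, 0, 0; rewrite !mulr0z mulr1z !addr0 add0r.
- by exists 0, 1, 0, 0; rewrite !mulr0z mulr1z !addr0 add0r pure_symAC.
- by exists 0, 0, 1, 0; rewrite !mulr0z mulr1z !addr0 !add0r.
- by exists 0, 1, 0, 0; rewrite !mulr0z mulr1z !addr0 add0r pure_symC pure_symAC.
- by exists 0, 0, 1, 0; rewrite !mulr0z mulr1z !addr0 !add0r pure_symC.
- by exists 0, 0, 1, 0; rewrite !mulr0z mulr1z !addr0 !add0r pure_symAC pure_symC.
- by exists 0, 0, 0, 1; rewrite !mulr0z mulr1z !add0r.
Qed.

End Eps.

(** Write r = a x^3 + b x^2 y + c x y^2 + d y^3. The invariant says that b is even; the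
    substitutions (1, 0), (0, 1) and (1, 1) say that a, d and a + b + c + d are even; hence c is
    even too. The factor 3 is the one by which [ret] multiplies such forms later. *)
Lemma spow_row2_even (r : spow 3 (rowf 2)) :
  eps r = 0 ->
  (forall x y : rowf 1, (x, y) \in [:: (dx 0, 0); (0, dx 0); (dx 0, dx 0)] ->
     exists b, spow_map 3 (lin (fun i : 'I_2 => nth x [:: x; y] i)) (r *+ 3) = b *+ 6) ->
  exists w, r = w *+ 2.
Proof.
have [a [b [c [d rE]]]] := spow_row2_expand r.
move=> er even_r.
have map_r (x y : rowf 1) (k l : int) : row_coord 0 x = k -> row_coord 0 y = l ->
    (x, y) \in [:: (dx 0, 0); (0, dx 0); (dx 0, dx 0)] ->
    exists m, a * k ^+ 3 + b * (k ^+ 2 * l) + c * (k * l ^+ 2) + d * l ^+ 3 = m * 2%:R.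
  move=> xk yl /even_r[w E]; exists (smul (row_coord 0) w).
  have mapE : smul (row_coord 0) (spow_map 3 (lin (fun i : 'I_2 => nth x [:: x; y] i)) r) =
      a * k ^+ 3 + b * (k ^+ 2 * l) + c * (k * l ^+ 2) + d * l ^+ 3.
    rewrite rE !raddfD !raddfMz /= !spow_map_pure !t3_map !lin_dx /=.
    by rewrite !smul_pure xk yl !mulrzz; ring.
  have : smul (row_coord 0) (spow_map 3 (lin (fun i : 'I_2 => nth x [:: x; y] i)) r) *+ 3 =
      smul (row_coord 0) w *+ 6.
    by rewrite -(raddfMn (smul _)) -(raddfMn (smul _) 6) -E (raddfMn (spow_map 3 _)).
  (* From 3p = 6q follows p = 2q. *)
  rewrite mapE; set p := (X in X *+ 3); set q := smul _ _; lia.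
have c1 : row_coord 0 (dx 0 : rowf 1) = 1 by rewrite mkaddE mxE.
have c0 : row_coord 0 (0 : rowf 1) = 0 by rewrite raddf0.
have [|m am] := map_r _ _ _ _ c1 c0; first by rewrite !inE eqxx.
have [|m' dm] := map_r _ _ _ _ c0 c1; first by rewrite !inE eqxx orbT.
have [|m'' sm] := map_r _ _ _ _ c1 c1; first by rewrite !inE eqxx !orbT.
have [n bn] : exists n, b = n * 2%:R.
  move: er; rewrite rE !raddfD !raddfMz eps_xxx eps_xxy eps_xyy eps_yyy !mul0rz.
  rewrite add0r !addr0 => b0.
  have [n [|bn]] : exists n, b = n * 2%:R \/ b = n * 2%:R + 1.
  - by exists (b %/ 2)%Z; lia.
  - by exists n.
  have two0 : 1 *~ 2%:R = 0 :> 'Z_2 by apply: val_inj.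
  by move: b0; rewrite bn mulrzDr mulrC mulrzA two0 mul0rz add0r mulr1z => /eqP.
(* The coefficients are the halves of a, b, c and d; the half of c is that of the total minus those
   of the other three. *)
exists (pure_sym (t3 (dx 0) (dx 0) (dx 0)) *~ m + pure_sym (t3 (dx 0) (dx 0) (dx 1)) *~ n +
  pure_sym (t3 (dx 0) (dx 1) (dx 1)) *~ (m'' - m - n - m') +
  pure_sym (t3 (dx 1) (dx 1) (dx 1)) *~ m').
have dbl (p : spow 3 (rowf 2)) k : p *~ (k * 2%:R) = p *~ k *+ 2 by rewrite mulrzA.
rewrite !mulrnDl -!dbl rE; congr (_ *~ _ + _ *~ _ + _ *~ _ + _ *~ _).
all: by move: am dm sm; rewrite ?expr1n ?expr0n; lia.
Qed.

(** * Comparison of two extensions with the same invariant *)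

Section Compare.
Variables (E E' : extension (Gamma 3) (Sym 3)) (e : E (rowf 1)) (e' : E' (rowf 1)).
Hypotheses (pr_e : ext_pr E (rowf 1) e = g3 (dx 0))
           (pr_e' : ext_pr E' (rowf 1) e' = g3 (dx 0)).

Local Notation ret1 := (ret pr_e).
Local Notation ret2 := (ret pr_e').

(** Equality at [g] of the two maps from Gamma^3 to S^3/6 induced by the retractions. One pair of
    lifts suffices, because another lift changes a retraction by an element of 6 S^3. *)
Definition agree (V : fgfree) (g : gpow 3 V) : Prop := exists x x' b,
  [/\ ext_pr E V x = g, ext_pr E' V x' = g & ret1 V x - ret2 V x' = b *+ 6].

Lemma agree_any (V : fgfree) (g : gpow 3 V) : agree g -> forall x x', ext_pr E V x = g -> ext_pr E' V x' = g ->
  exists b, ret1 V x - ret2 V x' = b *+ 6.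
Proof.
move=> [y [y' [b [yg yg' yb]]]] x x' xg xg'.
have /ext_exact[c cE] : ext_pr E V (x - y) = 0 by rewrite raddfB xg yg subrr.
have /ext_exact[c' cE'] : ext_pr E' V (x' - y') = 0 by rewrite raddfB xg' yg' subrr.
exists (b + c - c'); rewrite mulrnBl mulrnDl -yb -(ret_in pr_e c) -(ret_in pr_e' c') cE cE'.
by rewrite !(raddfB (ret _ V)); zmodule.
Qed.

Lemma agree0 (V : fgfree) : agree (0 : gpow 3 V).
Proof. by exists 0, 0, 0; rewrite !raddf0 mul0rn addr0. Qed.

Lemma agreeB (V : fgfree) (g h : gpow 3 V) : agree g -> agree h -> agree (g - h).
Proof.
move=> [x [x' [b [xg xg' xb]]]] [y [y' [c [yg yg' yb]]]].
exists (x - y), (x' - y'), (b - c); split; first by rewrite raddfB xg yg.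
  by rewrite raddfB xg' yg'.
by rewrite mulrnBl -xb -yb !(raddfB (ret _ V)); zmodule.
Qed.

Lemma agree_map (V W : fgfree) (f : {additive V -> W}) (g : gpow 3 V) :
  agree g -> agree (gpow_map 3 f g).
Proof.
move=> [x [x' [b [xg xg' xb]]]].
exists (fmap E f x), (fmap E' f x'), (spow_map 3 f b).
rewrite !nt_natural xg xg'; split=> //.
by rewrite !ret_natural -raddfMn -xb raddfB.
Qed.

Lemma agree_g3 (V : fgfree) (x : V) : agree (g3 x).
Proof.
exists (ev e x), (ev e' x), 0; rewrite !pr_ev //; split=> //.
by rewrite !ret_ev subrr mul0rn.
Qed.

Let x : rowf 2 := dx 0.
Let y : rowf 2 := dx 1.

Variables (u : E (rowf 2)) (u' : E' (rowf 2)) (s s' : spow 3 (rowf 2)).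
Hypotheses (pr_u : ext_pr E (rowf 2) u = g21 x y)
           (pr_u' : ext_pr E' (rowf 2) u' = g21 x y).
Hypotheses (sE : ext_in E (rowf 2) s = u *+ 2 - cross3 e x x y)
           (sE' : ext_in E' (rowf 2) s' = u' *+ 2 - cross3 e' x x y).
Hypothesis ss' : eps s = eps s'.

(** The retractions differ at these lifts by 3(s - s'), so s - s' has to be even. Maps from Z^2 to Z
    send gamma_2(x) y into Gamma^3(Z), to 0 or to 3 gamma_3 for the three maps used, where agreement
    is known; this supplies the evaluations that [spow_row2_even] requires. *)
Lemma agree_g21_univ : agree (g21 x y).
Proof.
(* By symmetry [tau] takes the three terms of gamma_2(x) y to the same value T(x, x, y), so 6v - 3
   T(x, x, y) = 3(2v - T(x, x, y)). *)
have retE (F : extension (Gamma 3) (Sym 3)) (f : F (rowf 1)) pr_f v t :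
    ext_pr F (rowf 2) v = g21 x y -> ext_in F (rowf 2) t = v *+ 2 - cross3 f x x y ->
    @ret F f pr_f (rowf 2) v = t *+ 3.
  move=> pr_v tE; apply: (@ext_inj _ _ F (rowf 2)); rewrite retP pr_v raddfMn tE /=.
  by rewrite !(raddfD (tau pr_f _)) !tau_tri [cross3 f y x x]cross3C [cross3 f x y x]cross3AC; zmodule.
have rE : ret1 _ u - ret2 _ u' = (s - s') *+ 3.
  by rewrite (retE _ _ _ _ _ pr_u sE) (retE _ _ _ _ _ pr_u' sE') mulrnBl.
have [||w wE] := @spow_row2_even (s - s').
- by rewrite raddfB ss' subrr.
- move=> p q pq.
  have : agree (g21 p q).
    move: pq; rewrite !inE => /or3P[] /eqP[-> ->].
    + suff -> : g21 (dx 0) 0 = 0 :> gpow 3 (rowf 1) by exact: agree0.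
      by apply: gpow_inj; rewrite /= !tri0 !addr0.
    + suff -> : g21 0 (dx 0) = 0 :> gpow 3 (rowf 1) by exact: agree0.
      by apply: gpow_inj; rewrite /= !tri0 !addr0.
    have A := agree_g3 (dx 0 : rowf 1).
    (* This is gamma_2(z) z = 3 gamma_3(z), spelt with differences to fit [agreeB]. *)
    have -> : g21 (dx 0) (dx 0) = g3 (dx 0) - (0 - g3 (dx 0)) - (0 - g3 (dx 0)) :> gpow 3 (rowf 1).
      by apply: gpow_inj; rewrite /=; zmodule.
    have A0 := agreeB (agree0 _) A.
    by exact: (agreeB (agreeB A A0) A0).
  move=> /agree_any A; set f := lin _.
  have [||b bE] := A (fmap E f u) (fmap E' f u').
  + by rewrite nt_natural pr_u [LHS]gpow_map_g21 !lin_dx.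
  + by rewrite nt_natural pr_u' [LHS]gpow_map_g21 !lin_dx.
  by exists b; rewrite -bE -rE raddfB !ret_natural.
by exists u, u', w; split=> //; rewrite rE wE -mulrnA.
Qed.

Lemma agree_g21 (V : fgfree) (p q : V) : agree (g21 p q).
Proof.
have := agree_map (lin (fun i : 'I_2 => nth p [:: p; q] i)) agree_g21_univ.
by rewrite gpow_map_g21 !lin_dx.
Qed.

Lemma agree_all (V : fgfree) (g : gpow 3 V) : agree g.
Proof.
elim/gpow3_ind: g; [exact: agree0|exact: agreeB|exact: agree_g3|exact: agree_g21].
Qed.

(** The comparison map matches projection and retraction at once: agreement modulo 6 allows any lift
    to be corrected by S^3. Torsion-freeness makes the result unique, and uniqueness makes the map
    additive and natural. *)
Lemma compare_ex V (p : E V) :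
  exists p', ext_pr E' V p' = ext_pr E V p /\ ret2 V p' = ret1 V p.
Proof.
have [q qE] := ext_surj E' (ext_pr E V p).
have [b bE] := agree_any (agree_all (ext_pr E V p)) (erefl _) qE.
exists (q + ext_in E' V b); split.
  rewrite raddfD qE (_ : ext_pr E' V _ = 0) ?addr0 //.
  by apply/ext_exact; exists b.
by rewrite raddfD ret_in -bE addrC subrK.
Qed.

Lemma compare_uniq V (p q : E' V) :
  ext_pr E' V p = ext_pr E' V q -> ret2 V p = ret2 V q -> p = q.
Proof.
move=> pq rpq; have /ext_exact[b bE] : ext_pr E' V (p - q) = 0 by rewrite raddfB pq subrr.
have b0 : b *+ 6 = 0 by rewrite -(ret_in pr_e') bE raddfB rpq subrr.
apply/eqP; rewrite -subr_eq0 -bE; apply/eqP.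
by rewrite (spow3_torsion_free b0) raddf0.
Qed.

Definition compare_fun V (p : E V) : E' V := sval (cid (compare_ex p)).

Lemma compare_pr V (p : E V) : ext_pr E' V (compare_fun p) = ext_pr E V p.
Proof. by have [] := svalP (cid (compare_ex p)). Qed.

Lemma compare_ret V (p : E V) : ret2 V (compare_fun p) = ret1 V p.
Proof. by have [] := svalP (cid (compare_ex p)). Qed.

Lemma compare_is_zmod_morphism V : zmod_morphism (@compare_fun V).
Proof.
move=> p q; apply: compare_uniq; first by rewrite raddfB !compare_pr raddfB.
by rewrite raddfB !compare_ret raddfB.
Qed.

Lemma compare_natural (V W : fgfree) (f : {additive V -> W}) p :
  mkadd (@compare_is_zmod_morphism W) (fmap E f p) =
  fmap E' f (mkadd (@compare_is_zmod_morphism V) p).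
Proof.
rewrite !mkaddE; apply: compare_uniq.
  by rewrite compare_pr !nt_natural compare_pr.
by rewrite compare_ret !ret_natural compare_ret.
Qed.

Lemma compare_equiv : ext_equiv E E'.
Proof.
exists (NatTrans compare_natural); split=> V p /=; rewrite mkaddE; last exact: compare_pr.
apply: compare_uniq; last by rewrite compare_ret !ret_in.
rewrite compare_pr; transitivity (0 : Gamma 3 V).
  by apply/ext_exact; exists p.
by apply/esym/ext_exact; exists p.
Qed.

End Compare.

(** * The invariant *)


Local Notation gx := (dx 0 : rowf 2).
Local Notation gy := (dx 1 : rowf 2).

(** The invariant is a relation because it involves lifts [e] and [u]; independence of them is a
    separate statement. *)
Definition ext_inv (E : extension (Gamma 3) (Sym 3)) (a : 'Z_2) : Prop :=
  exists (e : E (rowf 1)) (u : E (rowf 2)) (s : spow 3 (rowf 2)),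
  [/\ ext_pr E (rowf 1) e = g3 (dx 0), ext_pr E (rowf 2) u = g21 gx gy,
      ext_in E (rowf 2) s = u *+ 2 - cross3 e gx gx gy & eps s = a].

Lemma ext_inv_inj E E' a : ext_inv E a -> ext_inv E' a -> ext_equiv E E'.
Proof.
move=> [e [u [s [eP uP sP sa]]]] [e' [u' [s' [eP' uP' sP' sa']]]].
by apply: (compare_equiv eP eP' uP uP' sP sP'); rewrite sa.
Qed.

Lemma ext_inv_ex E : exists a, ext_inv E a.
Proof.
have [e eP] := ext_surj E (g3 (dx 0 : rowf 1) : Gamma 3 (rowf 1)).
have [u uP] := ext_surj E (g21 gx gy : Gamma 3 (rowf 2)).
(* The norm of x (x) x (x) y contains each of its three rearrangements twice, so it equals 2
   gamma_2(x) y. *)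
have /ext_exact[s sP] : ext_pr E (rowf 2) (u *+ 2 - cross3 e gx gx gy) = 0.
  apply: gpow_inj; rewrite val_prB (pr_cross3 eP) (raddfMn (ext_pr E _)) uP norm3_tri raddfMn /=.
  by zmodule.
by exists (eps s), e, u, s.
Qed.

(* Changing the lift of the generator by [k] changes [cross3 e x x y] by the third
   difference of the cubic map defined by [k], which is even at (x, x, y). *)
Lemma sym_diff_even (V : fgfree) (k : spow 3 (rowf 1)) (x y : V) :
  let c z := spow_map 3 (lin (fun _ : 'I_1 => z)) k in
  exists w, c (x + x + y) - c (x + x) - c (x + y) - c (x + y) + c x + c x + c y - c 0 = w *+ 2.
Proof.
elim/spow_ind: k => [|k k' [w wE] [w' wE']|v] /=.
- by exists 0; rewrite !raddf0; zmodule.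
- exists (w - w'); rewrite mulrnBl -wE -wE' !(raddfB (spow_map 3 _)) /=.
  (* The cubic map takes six distinct values here, which become atoms. *)
  do 6!move: (spow_map 3 _ k) => ?.
  do 6!move: (spow_map 3 _ k') => ?.
  zmodule.
have linD (p q : V) r : lin (fun _ : 'I_1 => p + q) r = lin (fun _ => p) r + lin (fun _ => q) r.
  by rewrite !mkaddE -big_split; apply: eq_bigr => i _; rewrite mulrzDl.
have lin0 r : lin (fun _ : 'I_1 => 0 : V) r = 0.
  by rewrite mkaddE big1 // => i _; rewrite mul0rz.
rewrite !spow_map_pure -[v]t3_eta !t3_map; move: (v 0) (v 1) (v 2%:R) => a b c.
rewrite !linD !lin0 /pure_sym -!/(tri _ _ _).
move: (lin _ a) (lin _ b) (lin _ c) (lin _ a) (lin _ b) (lin _ c) => ya yb yc xa xb xc.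
(* The third difference at (x, x, y) places [y] in one of three positions and the two copies of x in
   the others, in two equal ways. *)
exists (\pi_(spow 3 V) (tri xa xb yc + tri xa yb xc + tri ya xb xc)).
rewrite -raddfMn -!(raddfB \pi_(spow 3 V), raddfD \pi_(spow 3 V)); congr \pi_(spow 3 V).
by rewrite !(triD, tri0); zmodule.
Qed.

(** Replacing u by u + t and e by e + k changes s by 2t minus the third difference of k at (x, x,
    y); both are even, so [eps] is unchanged. *)
Lemma ext_inv_uniq E a a' : ext_inv E a -> ext_inv E a' -> a = a'.
Proof.
move=> [e [u [s [eP uP sP <-]]]] [e' [u' [s' [eP' uP' sP' <-]]]].
have /ext_exact[k kE] : ext_pr E (rowf 1) (e' - e) = 0 by rewrite raddfB eP eP' subrr.
have /ext_exact[t tE] : ext_pr E (rowf 2) (u' - u) = 0 by rewrite raddfB uP uP' subrr.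
have [w wE] := sym_diff_even k gx gy.
pose c (z : rowf 2) : Sym 3 (rowf 2) := fmap (Sym 3) (lin (fun _ : 'I_1 => z)) k.
have cE z : ext_in E (rowf 2) (c z) = ev e' z - ev e z.
  by rewrite /c nt_natural kE raddfB !evE.
have {wE} : c (gx + gx + gy) - c (gx + gx) - c (gx + gy) - c (gx + gy) + c gx + c gx
    + c gy - c 0 = w *+ 2 := wE.
move: c cE => c cE wE.
have cross3_change : cross3 e' gx gx gy - cross3 e gx gx gy = ext_in E (rowf 2) (w *+ 2).
  rewrite -wE !(raddfB (ext_in E _), raddfD (ext_in E _)) !cE (cross3E e) (cross3E e').
  do 6!move: (ev e _) => ?.
  do 6!move: (ev e' _) => ?.
  zmodule.
have -> : s' = s + (t - w) *+ 2.
  apply: (@ext_inj _ _ E (rowf 2)); rewrite raddfD sP sP' mulrnBl raddfB -cross3_change.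
  by rewrite raddfMn tE mulrnBl; zmodule.
by rewrite raddfD eps_double addr0.
Qed.

Lemma ext_inv_equiv E E' a : ext_equiv E E' -> ext_inv E a -> ext_inv E' a.
Proof.
move=> [phi [phii phip]] [e [u [s [eP uP sP sa]]]].
exists (phi (rowf 1) e), (phi (rowf 2) u), s; rewrite !phip; split=> //.
rewrite -phii sP raddfB raddfMn !cross3E !(raddfB (phi _), raddfD (phi _)).
by rewrite !evE !nt_natural.
Qed.

Section BaerInv.
Variables (E1 E2 : extension (Gamma 3) (Sym 3)).

Definition mkfib (V : fgfree) x1 x2 (h : ext_pr E1 V x1 = ext_pr E2 V x2) : fib E1 E2 V.
Proof. by exists (x1, x2); apply/eqP. Defined.

(** Lifts in the two extensions pair up in the fibre product, where the computation is
    componentwise. *)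
Lemma ext_inv_baer a1 a2 :
  ext_inv E1 a1 -> ext_inv E2 a2 -> ext_inv (baer E1 E2) (a1 + a2).
Proof.
move=> [e1 [u1 [s1 [eP1 uP1 sP1 <-]]]] [e2 [u2 [s2 [eP2 uP2 sP2 <-]]]].
have eP : ext_pr E1 (rowf 1) e1 = ext_pr E2 (rowf 1) e2 by rewrite eP1.
have uP : ext_pr E1 (rowf 2) u1 = ext_pr E2 (rowf 2) u2 by rewrite uP1.
exists (\pi_(baer_obj E1 E2 (rowf 1)) (mkfib eP)),
       (\pi_(baer_obj E1 E2 (rowf 2)) (mkfib uP)), (s1 + s2).
split.
- by rewrite -eP1; exact: (baer_pr_funE (mkfib eP)).
- by rewrite -uP1; exact: (baer_pr_funE (mkfib uP)).
- pose c (z : rowf 2) := fib_map (lin (fun _ : 'I_1 => z)) (mkfib eP).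
  have ev_pi (z : rowf 2) : ev (E := baer E1 E2) (\pi_(baer_obj E1 E2 (rowf 1)) (mkfib eP)) z =
      \pi_(baer_obj E1 E2 (rowf 2)) (c z).
    by rewrite evE; exact: baer_mapE.
  rewrite cross3E !ev_pi -raddfMn -!(raddfB (\pi_(baer_obj E1 E2 (rowf 2))), raddfD (\pi_(baer_obj E1 E2 (rowf 2)))).
  (* The class of s1 + s2 is represented by (s1 + s2, 0), which differs from (s1, s2) by the
     antidiagonal element (s2, -s2). *)
  apply/quot_eqP/asboolP; exists s2.
  have cE z : subgp_val (c z) = (ev e1 z, ev e2 z) by rewrite !evE.
  move: c cE {ev_pi} => c cE.
  rewrite !(subgp_valB, subgp_valD, subgp_valMn) !cE.
  rewrite /= raddfD sP1 sP2 (cross3E e1) (cross3E e2).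
  apply: injective_projections; rewrite /=.
    by do 6!move: (ev e1 _) => ?; zmodule.
  by do 6!move: (ev e2 _) => ?; zmodule.
by rewrite raddfD.
Qed.

End BaerInv.


(** The coordinatewise product in a basis has x x = x modulo 2, because n^2 - n is even for every
    integer n. *)
Lemma fgfree_product (V : fgfree) : exists p : V -> V -> V,
  [/\ forall x, zmod_morphism (p x), forall x y, p x y = p y x &
      forall x, exists y, p x x = x + y *+ 2].
Proof.
have [n [c [b cb]]] := fgfree_dual_basis V.
exists (fun x y => \sum_i b i *~ (c i x * c i y)); split=> [x y z|x y|x].
- by rewrite -sumrB; apply: eq_bigr => i _; rewrite raddfB mulrBr mulrzBr.
- by apply: eq_bigr => i _; rewrite mulrC.
have ex i : exists m : int, c i x * c i x = c i x + m * 2%:R.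
  exists ((c i x * c i x - c i x) %/ 2)%Z; rewrite divzK; first by rewrite addrC subrK.
  have [m [->|->]] : exists m, c i x = m * 2%:R \/ c i x = m * 2%:R + 1.
    by exists (c i x %/ 2)%Z; lia.
  - by apply/dvdzP; exists (m * (m * 2%:R) - m); ring.
  by apply/dvdzP; exists (m * (m * 2%:R + 1)); ring.
pose m i := sval (cid (ex i)).
exists (\sum_i b i *~ m i); rewrite {3}[x]cb -sumrMnl -big_split.
apply: eq_bigr => i _; rewrite /= (svalP (cid (ex i))) -/(m i).
by rewrite mulrzDr mulrzA.
Qed.

(** * The nonsplit extension *)

Section Mod2.
Variable V : zmodType.
Implicit Types x y z : V.

Definition even_sym : {pred spow 3 V} := fun s => `[< exists w, s = w *+ 2 >].

Lemma even_sym_zmod_closed : zmod_closed even_sym.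
Proof.
split=> [|x y /asboolP[v ->] /asboolP[w ->]]; apply/asboolP; first by exists 0; rewrite mul0rn.
by exists (v - w); rewrite mulrnBl.
Qed.

HB.instance Definition _ :=
  GRing.isZmodClosed.Build (spow 3 V) even_sym even_sym_zmod_closed.

Definition spow_mod2 : zmodType := Quotient.quot even_sym.

Definition mod2 (s : spow 3 V) : spow_mod2 := \pi_spow_mod2 s.

Lemma mod2B s s' : mod2 (s - s') = mod2 s - mod2 s'.
Proof. by rewrite /mod2 raddfB. Qed.

Lemma mod2D s s' : mod2 (s + s') = mod2 s + mod2 s'.
Proof. by rewrite /mod2 raddfD. Qed.

Lemma mod2_0 : mod2 0 = 0.
Proof. exact: raddf0 \pi_spow_mod2. Qed.

Lemma mod2_eq0 s : mod2 s = 0 <-> exists w, s = w *+ 2.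
Proof.
rewrite /mod2 -[0](raddf0 \pi_spow_mod2); split=> [/quot_eqP|sw].
  by rewrite subr0 => /asboolP.
by apply/quot_eqP; rewrite subr0; apply/asboolP.
Qed.

Lemma mod2_double s : mod2 (s *+ 2) = 0.
Proof. by apply/mod2_eq0; exists s. Qed.

Lemma mod2_mul2 (m : spow_mod2) : m + m = 0.
Proof. by rewrite -[m]reprK -/(mod2 _) -mod2D -mulr2n mod2_double. Qed.

Definition beta x y : spow 3 V := pure_sym (t3 x x y) + pure_sym (t3 x y y).

Lemma pure_symE x y z : pure_sym (t3 x y z) = \pi_(spow 3 V) (tri x y z).
Proof. by []. Qed.

Lemma mod2_betaDl x x' y : mod2 (beta (x + x') y) = mod2 (beta x y) + mod2 (beta x' y).
Proof.
have -> : beta (x + x') y = beta x y + beta x' y + pure_sym (t3 x x' y) *+ 2.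
  rewrite /beta mulr2n {2}[pure_sym (t3 x x' y)]pure_symC !pure_symE -!(raddfD \pi_(spow 3 V)).
  by congr (\pi_(spow 3 V) _); rewrite !triD; zmodule.
by rewrite 2!mod2D mod2_double addr0.
Qed.

Lemma mod2_betaDr x y y' : mod2 (beta x (y + y')) = mod2 (beta x y) + mod2 (beta x y').
Proof.
have -> : beta x (y + y') = beta x y + beta x y' + pure_sym (t3 x y y') *+ 2.
  rewrite /beta mulr2n {2}[pure_sym (t3 x y y')]pure_symAC !pure_symE -!(raddfD \pi_(spow 3 V)).
  by congr (\pi_(spow 3 V) _); rewrite !triD; zmodule.
by rewrite 2!mod2D mod2_double addr0.
Qed.

Lemma mod2_beta_diag x : mod2 (beta x x) = 0.
Proof. by rewrite /beta -mulr2n mod2_double. Qed.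

End Mod2.

Section Mod2Map.
Variables (V W : zmodType) (f : {additive V -> W}).

Lemma mod2_map_subproof s : s \in @even_sym V -> spow_map 3 f s \in @even_sym W.
Proof.
move=> /asboolP[w ->]; apply/asboolP; exists (spow_map 3 f w).
by rewrite raddfMn.
Qed.

Definition mod2_map : {additive spow_mod2 V -> spow_mod2 W} :=
  quot_map _ _ _ mod2_map_subproof.

Lemma mod2_mapE s : mod2_map (mod2 s) = mod2 (spow_map 3 f s).
Proof. exact: quot_mapE. Qed.

Lemma spow_map_beta x y : spow_map 3 f (beta x y) = beta (f x) (f y).
Proof. by rewrite /beta raddfD /= !spow_map_pure !t3_map. Qed.

End Mod2Map.

Section Psi.
Variable V : fgfree.
Implicit Types x y z : V.

Definition prodV : V -> V -> V := sval (cid (fgfree_product V)).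

Lemma prodVC x y : prodV x y = prodV y x.
Proof. by rewrite /prodV; case: cid => p []. Qed.

Lemma prodVDr x y z : prodV x (y + z) = prodV x y + prodV x z.
Proof.
rewrite /prodV; case: cid => p [pB _ _] /=.
by rewrite -[LHS](mkaddE (pB x)) raddfD !mkaddE.
Qed.

Lemma prodV_diag x : exists y, prodV x x = x + y *+ 2.
Proof. by rewrite /prodV; case: cid => p []. Qed.

(** A map out of the invariants is obtained by restricting one from the whole tensor cube: the first
    two factors are multiplied, and [beta] pairs the product with the third. *)
Definition psi_fun (v : {ffun 'I_3 -> V}) : spow_mod2 V :=
  mod2 (beta (prodV (v 0) (v 1)) (v 2%:R)).

Lemma psi_multilinear : multilinear psi_fun.
Proof.
apply: multilinear3 => [x x' y z|x y y' z|x y z z']; rewrite /psi_fun !ffunE /=.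
- by rewrite prodVC prodVDr mod2_betaDl ![prodV y _]prodVC.
- by rewrite prodVDr mod2_betaDl.
- by rewrite mod2_betaDr.
Qed.

Definition psi : {additive tpow 3 V -> spow_mod2 V} := tlift psi_multilinear.

Lemma psi_tri x y z : psi (tri x y z) = mod2 (beta (prodV x y) z).
Proof. by rewrite /psi tliftE /psi_fun !ffunE. Qed.

Lemma mod2_beta_prodV x y : mod2 (beta (prodV x x) y) = mod2 (beta x y).
Proof.
by have [z ->] := prodV_diag x; rewrite mulr2n !mod2_betaDl mod2_mul2 addr0.
Qed.

Lemma psi_g3 x : psi (subgp_val (g3 x)) = 0.
Proof. by rewrite psi_tri mod2_beta_prodV mod2_beta_diag. Qed.

(** The term x (x) x (x) y gives beta(x x, y), which is beta(x, y) modulo 2; the other two terms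
    both give beta(x y, x) and cancel modulo 2. *)
Lemma psi_g21 x y : psi (subgp_val (g21 x y)) = mod2 (beta x y).
Proof.
by rewrite /= !raddfD !psi_tri mod2_beta_prodV [prodV y x]prodVC -addrA mod2_mul2 addr0.
Qed.

End Psi.

(* [psi] depends on a basis, but its restriction to Gamma^3 does not. *)
Lemma psi_natural (V W : fgfree) (f : {additive V -> W}) (g : gpow 3 V) :
  psi W (subgp_val (gpow_map 3 f g)) = mod2_map f (psi V (subgp_val g)).
Proof.
elim/gpow3_ind: g => [|g h Eg Eh|v|x y].
- by rewrite !raddf0.
- by rewrite raddfB !subgp_valB !raddfB Eg Eh.
- by rewrite gpow_map_g3 !psi_g3 raddf0.
by rewrite gpow_map_g21 !psi_g21 mod2_mapE spow_map_beta.
Qed.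

Section ModelObj.
Variable V : fgfree.

(** The fibre product of S^3 and Gamma^3 over S^3/2. The kernel of its projection to Gamma^3 is 2
    S^3, a copy of S^3 because S^3 is torsion free. *)
Definition model_pred : {pred (spow 3 V * gpow 3 V)%type} :=
  fun x => `[< mod2 x.1 = psi V (subgp_val x.2) >].

Lemma model_memP s g : (s, g) \in model_pred <-> mod2 s = psi V (subgp_val g).
Proof. by rewrite unfold_in; split=> [/asboolP|?] //; apply/asboolP. Qed.

Lemma model_zmod_closed : zmod_closed model_pred.
Proof.
split=> [|[s g] [s' g'] /model_memP xE /model_memP yE]; apply/model_memP.
  by rewrite [LHS](raddf0 \pi_(spow_mod2 V)) [RHS](raddf0 (psi V)).
change (mod2 (s - s') = psi V (subgp_val g - subgp_val g')).
by rewrite mod2B (raddfB (psi V)) xE yE.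
Qed.

HB.instance Definition _ :=
  GRing.isZmodClosed.Build (spow 3 V * gpow 3 V)%type model_pred model_zmod_closed.

Definition model_obj : zmodType := subgp model_pred.

End ModelObj.

Section ModelMap.
Variables (V W : fgfree) (f : {additive V -> W}).

Lemma model_map_subproof x :
  x \in @model_pred V -> pair_map (spow_map 3 f) (gpow_map 3 f) x \in @model_pred W.
Proof.
case: x => s g /model_memP sg; apply/model_memP.
by rewrite /= psi_natural -sg mod2_mapE.
Qed.

Definition model_map : {additive model_obj V -> model_obj W} :=
  mkadd (raddfB (sub_map _ _ _ model_map_subproof)).

Lemma model_mapE x :
  subgp_val (model_map x) = (spow_map 3 f (subgp_val x).1, gpow_map 3 f (subgp_val x).2).
Proof. by rewrite mkaddE. Qed.

End ModelMap.

Lemma model_inj V (x y : model_obj V) : subgp_val x = subgp_val y -> x = y.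
Proof. exact: val_inj. Qed.

Lemma model_map_id (V : fgfree) : model_map (idfun : {additive V -> V}) =1 idfun.
Proof.
move=> x; apply: model_inj; rewrite model_mapE /= (@spow_map_id 3 V) (@gpow_map_id 3 V).
by case: (subgp_val x).
Qed.

Lemma model_map_comp (U V W : fgfree) (g : {additive V -> W}) (f : {additive U -> V}) :
  model_map (g \o f : {additive U -> W}) =1 model_map g \o model_map f.
Proof.
by move=> x; apply: model_inj; rewrite /= !model_mapE /= spow_map_comp gpow_map_comp.
Qed.

Definition model_mid : functor := Functor model_map_id model_map_comp.

Section ModelExt.
Variable V : fgfree.

Lemma model_in_subproof (s : spow 3 V) : (s *+ 2, 0) \in @model_pred V.
Proof. by apply/model_memP; rewrite mod2_double !raddf0. Qed.

Lemma model_in_is_zmod_morphism :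
  zmod_morphism (fun s : Sym 3 V => Subgp (model_in_subproof s) : model_mid V).
Proof.
move=> s t; apply: model_inj; rewrite subgp_valB /= mulrnBl.
by rewrite -[in LHS](subr0 0).
Qed.

Definition model_in : {additive Sym 3 V -> model_mid V} := mkadd model_in_is_zmod_morphism.

Lemma model_inE s : subgp_val (model_in s : model_obj V) = (s *+ 2, 0).
Proof. by rewrite mkaddE. Qed.

Lemma model_pr_is_zmod_morphism :
  zmod_morphism (fun x : model_mid V => (subgp_val (x : model_obj V)).2 : Gamma 3 V).
Proof. by move=> x y; rewrite subgp_valB. Qed.

Definition model_pr : {additive model_mid V -> Gamma 3 V} := mkadd model_pr_is_zmod_morphism.

Lemma model_prE x : model_pr x = (subgp_val (x : model_obj V)).2.
Proof. by rewrite mkaddE. Qed.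

Lemma model_in_inj : injective model_in.
Proof.
apply: raddf_inj => s /(congr1 (fun x : model_obj V => (subgp_val x).1)).
rewrite model_inE raddf0 /=; exact: spow3_torsion_free.
Qed.

Lemma model_exact x : model_pr x = 0 <-> exists s, model_in s = x.
Proof.
rewrite model_prE; split=> [x0|[s <-]]; last by rewrite model_inE.
case: x x0 => -[s g] sg /= g0; have /mod2_eq0[w sw] : mod2 s = 0.
  by have /model_memP -> := sg; rewrite g0 !raddf0.
by exists w; apply: model_inj; rewrite model_inE /= sw g0.
Qed.

Lemma model_surj g : exists x, model_pr x = g.
Proof.
have sg : (repr (psi V (subgp_val g)), g) \in @model_pred V.
  by apply/model_memP; rewrite /mod2 reprK.
by exists (Subgp sg); rewrite model_prE.
Qed.

End ModelExt.

Lemma model_in_natural (V W : fgfree) (f : {additive V -> W}) s :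
  model_in W (fmap (Sym 3) f s) = fmap model_mid f (model_in V s).
Proof.
by apply: model_inj; rewrite model_mapE !model_inE raddfMn raddf0.
Qed.

Lemma model_pr_natural (V W : fgfree) (f : {additive V -> W}) x :
  model_pr W (fmap model_mid f x) = fmap (Gamma 3) f (model_pr V x).
Proof. by rewrite !model_prE [subgp_val _]model_mapE. Qed.

Definition model : extension (Gamma 3) (Sym 3) :=
  @Extension (Gamma 3) (Sym 3) model_mid (NatTrans model_in_natural)
    (NatTrans model_pr_natural) model_in_inj model_exact model_surj.

(** The generator lifts with S^3-component 0, so its third differences also have component 0. The
    lift (beta(x, y), gamma_2(x) y) then gives s = beta(x, y), in which x^2 y has coefficient 1. *)
Lemma model_inv : ext_inv model 1.
Proof.
have eP : (0, g3 (dx 0)) \in @model_pred (rowf 1).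
  by apply/model_memP; rewrite psi_g3 mod2_0.
have uP : (beta gx gy, g21 gx gy) \in @model_pred (rowf 2).
  by apply/model_memP; rewrite psi_g21.
exists (Subgp eP : model_obj _), (Subgp uP : model_obj _), (beta gx gy); split.
- exact: model_prE.
- exact: model_prE.
- apply: model_inj; rewrite [LHS]model_inE.
  pose c z : model_obj (rowf 2) := ev (E := model) (Subgp eP : model_obj (rowf 1)) z.
  have cE z : subgp_val (c z) = (0, g3 z).
    by rewrite /c evE [LHS]model_mapE /= raddf0 gpow_map_g3 lin_dx.
  rewrite cross3E -!/(c _); move: c cE => c cE.
  rewrite !(subgp_valB, subgp_valD, subgp_valMn) !cE.
  apply: injective_projections; rewrite /=; first by zmodule.
  by apply: gpow_inj; rewrite /= !(triD, tri0); zmodule.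
by rewrite /beta raddfD eps_xxy eps_xyy addr0.
Qed.

(** * The isomorphism between Ext^1 and Z/2 *)

Theorem mainTheorem4 :
  exists f : Ext1 (Gamma 3) (Sym 3) -> 'Z_2,
    bijective f /\ {morph f : x y / ext1_add x y >-> (x + y)%R}.
Proof.
pose f (c : Ext1 (Gamma 3) (Sym 3)) := sval (cid (ext_inv_ex (ext1_repr c))).
have fP c : ext_inv (ext1_repr c) (f c) by exact: svalP (cid _).
have fE E a : ext_inv E a -> f (ext1_of E) = a.
  apply: ext_inv_uniq; apply: ext_inv_equiv (fP _).
  by apply/ext1_of_eq; rewrite ext1_reprK.
have f_inj : injective f.
  move=> c d cd; rewrite -[c]ext1_reprK -[d]ext1_reprK; apply/ext1_of_eq.
  by apply: (@ext_inv_inj _ _ (f c)); [exact: fP | rewrite cd; exact: fP].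
have f_surj a : exists c, f c = a.
  (* The class 0 is written as 1 + 1 and realised by the Baer sum of [model] with itself. *)
  have [->|->] : a = 1 + 1 \/ a = 1.
    by case: a => [[|[|//]] lta]; [left|right]; apply: val_inj.
  - by exists (ext1_of (baer model model)); apply: fE; apply: ext_inv_baer; exact: model_inv.
  by exists (ext1_of model); apply: fE; exact: model_inv.
exists f; split; last by move=> c d; apply: fE; apply: ext_inv_baer; exact: fP.
pose g a := sval (cid (f_surj a)).
have gK : cancel g f by move=> a; exact: svalP (cid (f_surj a)).
by exists g => // c; apply: f_inj; rewrite gK.
Qed.
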